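(* Let $1\le p<\infty$ and let $q$ satisfy $\frac1p+\frac1q=1$. If $Z\subset\mathbb{R}^n$ is an asymmetric $L_1$-zonoid containing the origin, then $$|Z\oplus_p-Z|\le\kappa^{(s)}_{n,p}\,|Z|,\qquad\text{where}\qquad\kappa^{(s)}_{n,p}:=\sum_{i=0}^n\frac{\binom ni}{\binom{n/q}{i/q}} .$$ Equality holds if $Z$ is a parallelotope with a vertex at the origin.
   Context: $|\cdot|$ is Lebesgue measure on $\mathbb{R}^n$; $h_K(x)=\sup_{k\in K}\langle x,k\rangle$. For compact convex sets $K,L$ containing the origin, $K\oplus_pL$ is the compact convex set with $h_{K\oplus_pL}=(h_K^p+h_L^p)^{1/p}$; $-Z=\{-z:z\in Z\}$ and $Z\oplus_p-Z$ means $Z\oplus_p(-Z)$. An asymmetric $L_1$-zonoid is a Hausdorff limit of finite Minkowski sums of segments containing the origin. Binomial coefficients with real entries are $\binom xy=\frac{\Gamma(x+1)}{\Gamma(y+1)\Gamma(x-y+1)}$. For $p=1$ one has $q=\infty$ and $n/q=i/q=0$. *)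

(* Defs.v *)
(* R^n is 'rV[R]_n for R : realType. *)
From mathcomp Require Import all_boot all_order all_algebra.
From mathcomp Require Import all_classical all_reals all_analysis.

Set Implicit Arguments.
Unset Strict Implicit.
Unset Printing Implicit Defensive.

Import Order.TTheory GRing.Theory Num.Theory.
Import numFieldNormedType.Exports.

Local Open Scope classical_set_scope.
Local Open Scope ring_scope.

(* The n-fold product of the one-dimensional Lebesgue measure, written as an
   iterated integral of the measures of sections, as in the library's product
   measure.  It is meaningful on Borel sets. *)
Fixpoint lebesgue_rV (R : realType) (n : nat) : set 'rV[R]_n -> \bar R :=
  match n with
  | 0 => fun A => (\1_A 0)%:E
  | m.+1 => fun A =>
      (\int[lebesgue_measure]_x
         lebesgue_rV [set y : 'rV[R]_m | A (row_mx (x%:M : 'M[R]_1) y)%R])%E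
  end.

Definition dotv (R : realType) (n : nat) (x y : 'rV[R]_n) : R :=
  \sum_(i < n) x 0 i * y 0 i.

(* Used only for nonempty bounded K; the real-valued sup is 0 otherwise. *)
Definition support_fun (R : realType) (n : nat) (K : set 'rV[R]_n)
    (x : 'rV[R]_n) : R :=
  sup [set dotv x k | k in K].

(* "The" compact convex set with the prescribed support function.  M !=set0
   is needed because support_fun set0 = 0. *)
Definition Lp_sum (R : realType) (n : nat) (p : R) (K L : set 'rV[R]_n) :
    set 'rV[R]_n :=
  xget set0 [set M : set 'rV[R]_n |
    [/\ M !=set0, compact M,
        convex_set (M : set (convex_lmodType 'rV[R]_n)) &
        forall x, support_fun M x =
          (support_fun K x `^ p + support_fun L x `^ p) `^ p^-1]].

Definition segment (R : realType) (n : nat) (a b : 'rV[R]_n) : set 'rV[R]_n :=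
  [set (1 - t) *: a + t *: b | t in `[0, 1]].

Definition minkowski_sum (R : realType) (n m : nat)
    (S : 'I_m -> set 'rV[R]_n) : set 'rV[R]_n :=
  [set \sum_(i < m) x i | x in [set x : 'I_m -> 'rV[R]_n |
                                  forall i, S i (x i)]].

Definition asymmetric_L1_zonotope (R : realType) (n : nat)
    (P : set 'rV[R]_n) : Prop :=
  exists (m : nat) (a b : 'I_m -> 'rV[R]_n),
    (forall i, segment (a i) (b i) 0) /\
    P = minkowski_sum (fun i => segment (a i) (b i)).

(* Convergence to 0 of the Hausdorff distance.  The balls are those of the
   library's (maximum) norm; all norms on R^n give the same notion. *)
Definition hausdorff_cvg (R : realType) (n : nat) (P : nat -> set 'rV[R]_n)
    (Z : set 'rV[R]_n) : Prop :=
  forall e : R, 0 < e -> \forall k \near \oo,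
    P k `<=` \bigcup_(z in Z) ball z e /\
    Z `<=` \bigcup_(x in P k) ball x e.

(* Hausdorff limits are taken among compact sets. *)
Definition asymmetric_L1_zonoid (R : realType) (n : nat)
    (Z : set 'rV[R]_n) : Prop :=
  compact Z /\
  exists P : nat -> set 'rV[R]_n,
    (forall k, asymmetric_L1_zonotope (P k)) /\ hausdorff_cvg P Z.

(* Nondegenerate: the rows of V are n linearly independent edge vectors. *)
Definition parallelotope (R : realType) (n : nat) (Z : set 'rV[R]_n) : Prop :=
  exists (x : 'rV[R]_n) (V : 'M[R]_n), V \in unitmx /\
    Z = [set x + t *m V | t in [set t : 'rV[R]_n |
                                  forall i, 0 <= t 0 i <= 1]].

(* The vertices of a polytope are its extreme points. *)
Definition vertex (R : realType) (n : nat) (Z : set 'rV[R]_n)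
    (z : 'rV[R]_n) : Prop :=
  Z z /\ forall (a b : 'rV[R]_n) (t : R), Z a -> Z b -> 0 < t < 1 ->
    z = (1 - t) *: a + t *: b -> a = z /\ b = z.

(* Euler's integral, the Gamma function on x > 0. *)
Definition Gamma (R : realType) (x : R) : R :=
  Rintegral lebesgue_measure `]0, +oo[
    (fun t : R => t `^ (x - 1) * expR (- t)).

Definition binomR (R : realType) (x y : R) : R :=
  Gamma (x + 1) / (Gamma (y + 1) * Gamma (x - y + 1)).

(* kappa_{n,p}^{(s)}, as a function of the conjugate exponent q of p.  When
   q = +oo the extended-real quotients n / q and i / q are 0. *)
Definition kappa_s (R : realType) (n : nat) (q : \bar R) : R :=
  \sum_(i < n.+1)
    'C(n, i)%:R / binomR (fine (n%:R%:E / q)%E) (fine (i%:R%:E / q)%E).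

(* Main.v *)
Require Import Defs.
From HB Require Import structures.
From mathcomp Require Import all_boot all_order all_algebra.
From mathcomp Require Import all_classical all_reals all_analysis.
From mathcomp Require Import measurable_realfun.
From mathcomp Require Import ring lra.

Set Implicit Arguments.
Unset Strict Implicit.
Unset Printing Implicit Defensive.

Import Order.TTheory GRing.Theory Num.Theory.
Import numFieldNormedType.Exports.

Local Open Scope classical_set_scope.
Local Open Scope ring_scope.


(** Write [r = 1/q], and let [s, t >= 0] run over the curve
    [s ^ q + t ^ q = 1].  The theorem rests on four facts.

    - A zonoid [Z] as above is convex, and it is centrally symmetric because
      zonotopes are: [Z = w - Z] for some [w] ([zonoid_convex],
      [zonoid_symmetric]).
    - The [L_p] sum of [Z] and [-Z] is the union of the bodies [s Z - t Z] over
      the curve ([Lp_sumE]): by the equality case of Hoelder's inequality this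
      union has the required support function, it is convex because [x ^ r] is
      concave and [Z] contains the origin, and a compact convex set is
      determined by its support function.
    - Since [- Z = Z - w], the body [s Z - t Z] is a translate of [(s + t) Z],
      so that its volume is [(s + t) ^ n |Z|] ([lebesgue_diff_body]).  Move
      along the curve from [(0, 1)] to [(1, 0)].  When [(s, t)] becomes
      [(s', t')], with [s <= s'] and [t' <= t], the new body [s' Z - t' Z] and
      the old one both contain [s Z - t' Z]; hence at most
      [((s' + t') ^ n - (s + t') ^ n) |Z|] of the new volume was not covered
      before.  Summing over a fine subdivision, the volume of the union is at
      most [|Z|] times [1 + int_0^1 n (s + t) ^ (n - 1) ds].
      If [Z] is a parallelotope with a vertex at the origin, then in suitable
      coordinates [Z = [0, 1] ^ n] and [s Z - t Z = [- t, s] ^ n], so that the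
      new body meets the union of all the old ones exactly in [s Z - t' Z]
      ([diff_body_inter]), and there is equality.
    - By the binomial formula the last integral is a combination of
      [int_0^1 t ^ (n - i) d(s ^ i)] for [1 <= i <= n], and Euler's beta
      integral gives these the value [1 / binomR (n / q) (i / q)]
      ([beta_sum_bounds]); the leading [1] is the term [i = 0].

    No integral along the curve is ever formed.  For the subdivision
    [s_k = k / N] the upper and the lower Stieltjes sums bound both the
    constant [kappa] ([kappa_bounds]) and the volume ([lp_body_volume_le],
    [lp_body_volume_ge]), and they differ by [O(1 / N)] ([volume_sum_gap]).
    For [p = 1] the union is the single body [Z - Z], of volume
    [2 ^ n |Z|]. *)

(** * Lebesgue measure on row vectors *)

Section rV_measurable.
Variable R : realType.
Implicit Types n : nat.

Definition coord_preimages n : set (set 'rV[R]_n) :=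
  [set A | exists (i : 'I_n) (B : set (measurableTypeR R)),
     measurable B /\ A = [set x : 'rV[R]_n | B (x 0 i)]].

(** The sigma-algebra is generated by the coordinates, so that prepending a
    coordinate to a row is measurable by construction; that closed sets belong
    to it is [closed_measurable_rV]. *)
Definition rV_measurableType n := g_sigma_algebraType (@coord_preimages n).

Definition cons_rV n (z : measurableTypeR R * rV_measurableType n) :
    rV_measurableType n.+1 :=
  row_mx (z.1%:M : 'M[R]_1) z.2.

Lemma cons_rV0 n z : (@cons_rV n z : 'rV[R]_n.+1) 0 ord0 = z.1.
Proof.
have -> : (ord0 : 'I_n.+1) = lshift n (ord0 : 'I_1) by exact: val_inj.
apply: etrans (row_mxEl (z.1%:M : 'M[R]_1) (z.2 : 'rV[R]_n) 0 ord0) _.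
by rewrite mxE eqxx.
Qed.

Lemma cons_rVS n z j :
  (@cons_rV n z : 'rV[R]_n.+1) 0 (lift ord0 j) = (z.2 : 'rV[R]_n) 0 j.
Proof.
have -> : lift ord0 j = rshift 1 j by exact: val_inj.
exact: (row_mxEr (z.1%:M : 'M[R]_1) (z.2 : 'rV[R]_n)).
Qed.

Lemma measurable_coord n (i : 'I_n) :
  measurable_fun [set: rV_measurableType n]
    (fun x : rV_measurableType n => (x : 'rV[R]_n) 0 i : measurableTypeR R).
Proof.
move=> _ B mB; rewrite setTI; apply: sub_gen_smallest.
by exists i, B.
Qed.

Lemma measurable_cons_rV n : measurable_fun setT (@cons_rV n).
Proof.
refine (@measurability _ _ _ (rV_measurableType n.+1) _ _
  (@coord_preimages n.+1) erefl _).
move=> _ [_ [i [B [mB ->]]] <-]; rewrite setTI.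
have [j ->|->] := unliftP ord0 i.
  have -> : @cons_rV n @^-1` [set x : 'rV[R]_n.+1 | B (x 0 (lift ord0 j))] =
      (snd : measurableTypeR R * rV_measurableType n -> rV_measurableType n)
        @^-1` [set x : 'rV[R]_n | B (x 0 j)].
    by apply/seteqP; split => z; rewrite /preimage/= cons_rVS.
  rewrite -[X in measurable X]setTI; apply: measurable_snd => //.
  by apply: sub_gen_smallest; exists j, B.
have -> : @cons_rV n @^-1` [set x : 'rV[R]_n.+1 | B (x 0 ord0)] =
    fst @^-1` B.
  by apply/seteqP; split => z; rewrite /preimage/= cons_rV0.
by rewrite -[X in measurable X]setTI; exact: measurable_fst.
Qed.

Lemma sigma_finite_pushforward_cons n
    (m : {sigma_finite_measure set (rV_measurableType n) -> \bar R}) :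
  sigma_finite setT
    (pushforward (lebesgue_measure \x m)%E (@cons_rV n)).
Proof.
have /sigma_finiteP [F [FT ndF Foo]] := sigma_finiteT (@lebesgue_measure R).
have /sigma_finiteP [G [GT ndG Goo]] := sigma_finiteT m.
pose uncons (x : rV_measurableType n.+1) :
    measurableTypeR R * rV_measurableType n :=
  ((x : 'rV[R]_n.+1) 0 0, \row_j (x : 'rV[R]_n.+1) 0 (lift ord0 j)).
have unconsK : cancel (@cons_rV n) uncons.
  move=> [a y]; rewrite /uncons cons_rV0; congr (_, _).
  by apply/rowP => j; rewrite mxE cons_rVS.
have muncons : measurable_fun setT uncons.
  apply/measurable_fun_pairP; split => /=.
    exact: (measurable_coord (ord0 : 'I_n.+1)).
  refine (@measurability _ _ _ (rV_measurableType n) _ _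
    (@coord_preimages n) erefl _).
  move=> _ [_ [i [B [mB ->]]] <-]; rewrite setTI.
  apply: sub_gen_smallest; exists (lift ord0 i), B; split => //.
  by apply/seteqP; split => z /=; rewrite mxE.
exists (fun k => uncons @^-1` (F k `*` G k)).
  rewrite -preimage_bigcup (_ : \bigcup_k _ = setT) ?preimage_setT//.
  apply/seteqP; split => // -[x y] _.
  have : setT x by []. have : setT y by [].
  rewrite GT FT => -[k _ Gky] [l _ Flx]; exists (maxn k l) => //; split => /=.
    by move: x Flx; exact/subsetPset/ndF/leq_maxr.
  by move: y Gky; exact/subsetPset/ndG/leq_maxl.
move=> k; have [mF Fk] := Foo k; have [mG Gk] := Goo k.
split.
  rewrite -[X in measurable X]setTI; apply: muncons => //.
  exact: measurableX.
rewrite /pushforward -comp_preimage (_ : uncons \o @cons_rV n = idfun);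
  last exact/funext.
by rewrite preimage_id product_measure1E// lte_mul_pinfty// ge0_fin_numE.
Qed.

(** The recursive clause of [lebesgue_rV] is the measure of a preimage under
    [cons_rV] for the product of [lebesgue_measure] and the measure in one
    dimension less; sigma-finiteness goes through the induction because the
    product measure requires it. *)
Lemma lebesgue_rV_sigma_finite_measure n :
  exists m : {sigma_finite_measure set (rV_measurableType n) -> \bar R},
    (m : set _ -> \bar R) = @lebesgue_rV R n.
Proof.
elim: n => [|n [m mE]].
  by exists (\d_(0 : rV_measurableType 0)).
pose m' := measure_function_pushforward__canonical__measure_function_Measure
  (lebesgue_measure \x m)%E (@measurable_cons_rV n).
pose sf :=
  Measure_isSigmaFinite.Build _ _ _ m' (sigma_finite_pushforward_cons m).
pose M : {sigma_finite_measure set (rV_measurableType n.+1) -> \bar R} :=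
  HB.pack (m' : set _ -> \bar R) m' sf.
exists M.
apply/funext => A /=.
rewrite /m' /= /pushforward /product_measure1 mE.
apply: eq_integral => x _ /=; congr lebesgue_rV.
by apply/seteqP; split => y; rewrite /xsection/= inE.
Qed.
End rV_measurable.

Section rV_measure_theory.
Variable R : realType.

Section instance.
Variable n : nat.
Local Notation mu := (@lebesgue_rV R n : set (rV_measurableType R n) -> \bar R).

Let mu0 : mu set0 = 0%E.
Proof.
by have [m <-] := lebesgue_rV_sigma_finite_measure R n; exact: measure0.
Qed.

Let mu_ge0 A : (0 <= mu A)%E.
Proof.
by have [m <-] := lebesgue_rV_sigma_finite_measure R n; exact: measure_ge0.
Qed.

Let mu_sigma_additive : semi_sigma_additive mu.
Proof.
have [m <-] := lebesgue_rV_sigma_finite_measure R n.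
exact: measure_semi_sigma_additive.
Qed.

HB.instance Definition _ := isMeasure.Build _ _ _ mu
  mu0 mu_ge0 mu_sigma_additive.

Let mu_sigma_finite : sigma_finite setT mu.
Proof.
have [m <-] := lebesgue_rV_sigma_finite_measure R n.
exact: sigma_finiteT.
Qed.

HB.instance Definition _ := Measure_isSigmaFinite.Build _ _ _ mu
  mu_sigma_finite.
End instance.


(** The image of Lebesgue measure under [x |-> c x + v] agrees with [c^-1] times
    Lebesgue measure on half-open intervals, hence everywhere. *)
Lemma ge0_integral_affine (c v : R) (f : measurableTypeR R -> \bar R) : 0 < c ->
  measurable_fun setT f ->
  (forall x, 0 <= f x)%E ->
  (\int[lebesgue_measure]_x f (c * x + v)%R =
   c^-1%:E * \int[lebesgue_measure]_x f x)%E.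
Proof.
move=> c0 mf f0.
pose phi (x : measurableTypeR R) : measurableTypeR R := c * x + v.
have mphi : measurable_fun setT phi.
  by apply: measurable_funD => //; exact: measurable_funM.
pose pu := measure_function_pushforward__canonical__measure_function_Measure
  (@lebesgue_measure R) mphi.
pose k : {nonneg R} := NngNum (ltW c0).
transitivity (\int[pu]_x f x)%E; first by rewrite ge0_integral_pushforward.
have puE A : measurable A -> @lebesgue_measure R A = mscale k pu A.
  move=> mA; apply: lebesgue_measure_unique => // _ [[a b] _ <-] /=.
  rewrite /mscale /= /pushforward lebesgue_measure_itv/=.
  have -> : phi @^-1` `]a, b] = `](a - v) / c, (b - v) / c]%classic.
    apply/seteqP; split => x /=; rewrite /phi !in_itv/=.
      by rewrite ltr_pdivrMr// ler_pdivlMr// ltrBlDr lerBrDr mulrC.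
    by rewrite ltr_pdivrMr// ler_pdivlMr// ltrBlDr lerBrDr mulrC.
  rewrite lebesgue_measure_itv/= !lte_fin ltr_pM2r ?invr_gt0// ltrD2r.
  case: ifPn => _; last by rewrite mule0.
  by rewrite -!EFinB -EFinM; congr EFin; field; rewrite gt_eqF.
rewrite [in RHS](eq_measure_integral (mscale k pu));
  last by move=> A mA _; exact: puE.
by rewrite ge0_integral_mscale//= muleA -EFinM mulVf ?gt_eqF// mul1e.
Qed.

(** The sections of the preimage are preimages of sections under a map of the
    same form, so the one-dimensional change of variables is applied once per
    coordinate. *)
Lemma lebesgue_rV_affine n (c : R) (v : 'rV[R]_n)
    (A : set (rV_measurableType R n)) : 0 < c -> measurable A ->
  (lebesgue_rV [set x : 'rV[R]_n | A (c *: x + v)%R] =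
   (c^-1 ^+ n)%:E * lebesgue_rV A)%E.
Proof.
move=> c0; elim: n v A => [v A _|n IH v A mA].
  rewrite expr0 mul1e /=; congr EFin; rewrite !indicE; congr (_%:R).
  congr nat_of_bool; apply/idP/idP; rewrite !inE/= (_ : c *: 0 + v = 0)//;
    by apply/rowP => -[].
have msec x : measurable [set y | A (cons_rV (x, y))].
  have := @measurable_cons_rV R n measurableT A mA; rewrite setTI.
  move=> /(measurable_xsection x); congr measurable.
  by apply/seteqP; split => y; rewrite /xsection/= inE.
have mint : measurable_fun setT (fun x : measurableTypeR R =>
    lebesgue_rV [set y | A (cons_rV (x, y))]).
  have := @measurable_cons_rV R n measurableT A mA; rewrite setTI.
  move=> /(measurable_fun_xsection (@lebesgue_rV R n)).
  congr (measurable_fun _ _).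
  apply/funext => x /=; congr lebesgue_rV.
  by apply/seteqP; split => y; rewrite /xsection/= inE.
pose v' : 'rV[R]_n := \row_j v 0 (lift ord0 j).
have consE x y :
    c *: cons_rV (x, y) + v = cons_rV (c * x + v 0 ord0, c *: y + v').
  apply/rowP => i; rewrite [LHS]mxE [X in X + _]mxE.
  have [j ->|->] := unliftP ord0 i; last by rewrite !cons_rV0.
  by rewrite !cons_rVS/= [RHS]mxE [X in _ = X + _]mxE [X in _ = _ + X]mxE.
transitivity (\int[lebesgue_measure]_x ((c^-1 ^+ n)%:E *
    lebesgue_rV [set y | A (cons_rV ((c * x + v ord0 ord0)%R, y))]))%E.
  apply: eq_integral => x _; rewrite -(IH v'); last exact: msec.
  congr lebesgue_rV; apply/seteqP; split => y /=.
    by rewrite -(consE x y).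
  by rewrite -(consE x y).
rewrite ge0_integralZl//.
- rewrite (@ge0_integral_affine c _
    (fun x => lebesgue_rV [set y | A (cons_rV (x, y))]))//.
  by rewrite muleA -EFinM -exprSr.
- apply: (measurableT_comp mint).
  by apply: measurable_funD => //; exact: measurable_funM.
- by rewrite lee_fin exprn_ge0// invr_ge0 ltW.
Qed.

End rV_measure_theory.

Section compact_sets.
Variable R : realType.

Lemma coord_le_norm n (x : 'rV[R]_n) i : `|x 0 i| <= `|x|.
Proof.
rewrite [leRHS]/Num.norm /= mx_normrE.
exact: (@le_bigmax _ _ _ _ (fun ij : 'I_1 * 'I_n => `|x ij.1 ij.2|) (0, i)).
Qed.

Lemma measurable_box n (A : 'I_n -> set (measurableTypeR R)) :
  (forall i, measurable (A i)) ->
  measurable ([set x : 'rV[R]_n | forall i, A i (x 0 i)]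
    : set (rV_measurableType R n)).
Proof.
move=> mA.
have -> : [set x : 'rV[R]_n | forall i, A i (x 0 i)] =
    \bigcap_(i in [set: 'I_n]) [set x : 'rV[R]_n | A i (x 0 i)].
  by apply/seteqP; split => [x Ax i _ //|x Ax i]; exact: Ax.
apply: fin_bigcap_measurable => // i _.
by apply: sub_gen_smallest; exists i, (A i).
Qed.

(** A closed set is the intersection over [N] of the unions of those cells of
    the grid of mesh [1 / (N + 1)] that meet it. *)
Lemma closed_measurable_rV n (K : set 'rV[R]_n) :
  closed K -> measurable (K : set (rV_measurableType R n)).
Proof.
move=> cK.
pose cell (N : nat) (z : 'rV[int]_n) : set (rV_measurableType R n) :=
  [set x : 'rV[R]_n | forall i,
     (z 0 i)%:~R <= N.+1%:R * x 0 i < (z 0 i + 1)%:~R].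
have mcell N z : measurable (cell N z).
  pose B i : set (measurableTypeR R) :=
    `[(z 0 i)%:~R / N.+1%:R, (z 0 i + 1)%:~R / N.+1%:R[%classic.
  rewrite (_ : cell N z = [set x : 'rV[R]_n | forall i, B i (x 0 i)]).
    by apply: measurable_box => i; exact: measurable_itv.
  by apply/seteqP; split => x /= xz i; have := xz i; rewrite /B/= in_itv/=
    ler_pdivrMr// ltr_pdivlMr// [x 0 i * _]mulrC.
have -> : K = \bigcap_N \bigcup_(z in [set z | cell N z `&` K !=set0]) cell N z.
  apply/seteqP; split => [x Kx N _|x xK].
    pose z : 'rV[int]_n := \row_i Num.floor (N.+1%:R * x 0 i).
    have xz : cell N z x.
      by move=> i; rewrite !mxE; exact: floor_itv.
    by exists z => //; exists x.
  apply: cK => /= B /nbhs_ballP[e /= e0 xeB].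
  have [N Ne] : exists N : nat, N.+1%:R^-1 < e.
    exists (Num.truncn e^-1); rewrite invf_plt ?posrE//.
    exact: truncnS_gt.
  have [z [k [kz Kk]] xz] := xK N I.
  exists k; split => //; apply: xeB; split => // i j.
  rewrite ord1; apply: le_lt_trans Ne.
  have := kz j; have := xz j; rewrite intrD => /andP[x1 x2] /andP[k1 k2].
  rewrite /ball_ -(ler_pM2l (ltr0Sn R N)) mulfV ?pnatr_eq0//.
  rewrite -[N.+1%:R in leLHS]ger0_norm// -normrM ler_norml mulrBr.
  by apply/andP; split; lra.
apply: bigcapT_measurable => N; rewrite bigcup_mkcond.
apply: countable_bigcupT_measurable; first exact: countableP.
by move=> z; case: ifPn.
Qed.

Lemma compact_measurable_rV n (K : set 'rV[R]_n) :
  compact K -> measurable (K : set (rV_measurableType R n)).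
Proof.
move=> cK; by apply: closed_measurable_rV; apply: compact_closed.
Qed.

Lemma lebesgue_rV_cube n (M : R) : 0 <= M ->
  lebesgue_rV [set x : 'rV[R]_n | forall i, `|x 0 i| <= M] =
  ((M *+ 2) ^+ n)%:E.
Proof.
move=> M0; elim: n => [|n IH].
  by rewrite /= indicE mem_set//= => -[].
transitivity (\int[lebesgue_measure]_x (((M *+ 2) ^+ n)%:E *
    (\1_(`[- M, M]%classic : set (measurableTypeR R)) x)%:E))%E.
  apply: eq_integral => x _; rewrite indicE.
  have [/set_mem/=|/negP] := boolP (x \in _).
    rewrite in_itv/= -ler_norml mule1 -IH => xM; congr lebesgue_rV.
    apply/seteqP; split => y /=.
      by move=> yM i; have := yM (lift ord0 i); rewrite (cons_rVS (x, y)).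
    move=> yM i; have [j ->|->] := unliftP ord0 i.
      by rewrite (cons_rVS (x, y)).
    by rewrite (cons_rV0 (x, y)).
  rewrite inE/= in_itv/= -ler_norml => xM; rewrite mule0.
  rewrite -(measure0 (@lebesgue_rV R n)); congr lebesgue_rV.
  by apply/seteqP; split => y //= /(_ ord0); rewrite (cons_rV0 (x, y)).
rewrite ge0_integralZl//; last 2 first.
- exact: measurableT_comp.
- by rewrite lee_fin exprn_ge0// mulrn_wge0.
rewrite integral_indic// setIT.
rewrite [X in (_ * X)%E]lebesgue_measure_itv/= lte_fin.
have [|] := ltP (- M) M => MM.
  by rewrite -EFinB -EFinM opprK -mulr2n exprSr.
have -> : M = 0 by lra.
by rewrite mule0 mul0rn exprS mul0r.
Qed.

Lemma compact_lebesgue_rV_fin n (K : set 'rV[R]_n) :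
  compact K -> lebesgue_rV K \is a fin_num.
Proof.
move=> cK; rewrite ge0_fin_numE; last exact: measure_ge0.
have [M [_ KM]] := compact_bounded cK.
have M0 : 0 <= Num.max 0 (M + 1) by rewrite le_max lexx.
apply: (@le_lt_trans _ _
  (lebesgue_rV [set x : 'rV[R]_n | forall i, `|x 0 i| <= Num.max 0 (M + 1)])).
  apply: le_measure.
  - by rewrite inE; exact: compact_measurable_rV.
  - rewrite inE; apply: (@measurable_box n (fun=> [set x | `|x| <= _])) => i.
    rewrite (_ : [set x : R | _] =
      `[- Num.max 0 (M + 1), Num.max 0 (M + 1)]%classic).
      exact: measurable_itv.
    by apply/seteqP; split => x /=; rewrite in_itv/= ler_norml.
  - move=> x /(KM (M + 1)); rewrite ltrDl ltr01 => /(_ isT) xM i /=.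
    rewrite le_max; apply/orP; right; apply: le_trans xM.
    exact: coord_le_norm.
by rewrite lebesgue_rV_cube// ltry.
Qed.

End compact_sets.

(** * The Gamma function and beta sums *)

Lemma lebesgue_stieltjes_measure_itvoc (R : realType) (f : cumulative R R)
    (x y : R) : x <= y ->
  lebesgue_stieltjes_measure f `]x, y]%classic = (f y - f x)%:E.
Proof.
move=> xy; rewrite /lebesgue_stieltjes_measure /measure_extension/=.
rewrite measurable_mu_extE/= ?wlength_itv_bnd//; exact: is_ocitv.
Qed.

Section powR_stieltjes.
Variables (R : realType) (a : R) (a0 : 0 < a).

(** Truncated below at [0], since [powR] takes the value [1] at negative
    numbers. *)
Definition powR_plus (x : R) : R := Num.max 0 x `^ a.

Lemma powR_plusE x : 0 <= x -> powR_plus x = x `^ a.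
Proof. by move=> x0; rewrite /powR_plus max_r. Qed.

Lemma powR_plus_nd : nondecreasing powR_plus.
Proof.
move=> x y xy; apply: ge0_ler_powR; rewrite ?nnegrE; first exact: ltW.
- by rewrite le_max lexx.
- by rewrite le_max lexx.
- by rewrite ge_max !le_max lexx/= xy orbT.
Qed.

Lemma powR_plus_continuous : continuous powR_plus.
Proof.
move=> x; rewrite /continuous_at; have [x0|x0|x0] := ltgtP x 0.
- have -> : powR_plus x = 0 by rewrite /powR_plus max_l ?powR0 ?gt_eqF// ltW.
  apply: cvg_near_cst; near=> y.
  rewrite /powR_plus max_l ?powR0 ?gt_eqF//.
  by near: y; apply: filterS (lt_nbhsl x0) => y; exact: ltW.
- rewrite powR_plusE; last exact: ltW.
  apply: (@cvg_trans _ (y `^ a @[y --> x])).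
    apply: near_eq_cvg; near=> y.
    rewrite -/(powR_plus y) powR_plusE//; near: y.
    by apply: filterS (lt_nbhsr x0) => y; exact: ltW.
  have /derivable1_diffP/differentiable_continuous cx :
    derivable (@powR R ^~ a : R -> R) x 1
      by apply: derivable_powR; rewrite in_itv/= andbT.
  exact: cx.
- rewrite x0 powR_plusE// powR0 ?gt_eqF//.
  apply/(@cvgrPdist_lt _ R^o) => e e0; near=> y.
  rewrite sub0r normrN ger0_norm; last exact: powR_ge0.
  have -> : e = (e `^ a^-1) `^ a by rewrite -powRrM mulVf ?powRr1 ?gt_eqF// ltW.
  apply: gt0_ltr_powR; rewrite ?nnegrE ?le_max ?lexx ?powR_ge0//.
  rewrite gt_max powR_gt0//=; near: y.
  by apply: lt_nbhsl; exact: powR_gt0.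
Unshelve. all: by end_near. Qed.

Definition powR_cumulative : cumulative R R :=
  HB.pack powR_plus
    (isCumulative.Build R _ R powR_plus powR_plus_nd
      (right_continuousW powR_plus_continuous)).

(** The measure [d(x ^ a)] on the half-line.  As a Stieltjes measure it avoids
    the density [a x ^ (a - 1)], which is singular at [0] when [a < 1]. *)
Definition powR_measure := lebesgue_stieltjes_measure powR_cumulative.
HB.instance Definition _ := SigmaFiniteMeasure.on powR_measure.

Lemma powR_measure_itv (x y : R) : 0 <= x <= y ->
  powR_measure `]x, y]%classic = (y `^ a - x `^ a)%:E.
Proof.
move=> /andP[x0 xy].
rewrite /powR_measure lebesgue_stieltjes_measure_itvoc//= !powR_plusE//.
exact: le_trans xy.
Qed.

End powR_stieltjes.

Section gamma_density.
Variable R : realType.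
Implicit Types (a b t : R).
Local Notation leb := (@lebesgue_measure R).

(** The half-line is closed at [0] so that [gamma_density_lt0] and
    [gamma_densityE] leave no exceptional point. *)
Definition gamma_density a (t : measurableTypeR R) : R :=
  \1_(`[0, +oo[%classic : set (measurableTypeR R)) t * (t `^ a * expR (- t)).

Definition gamma_mass a : \bar R := (\int[leb]_t (gamma_density a t)%:E)%E.

Lemma gamma_densityE a t : 0 <= t -> gamma_density a t = t `^ a * expR (- t).
Proof.
by move=> t0; rewrite /gamma_density indicE mem_set/= ?in_itv/= ?t0// mul1r.
Qed.

Lemma gamma_density_lt0 a t : t < 0 -> gamma_density a t = 0.
Proof.
move=> t0; rewrite /gamma_density indicE memNset/= ?mul0r//.
by rewrite in_itv/= andbT leNgt t0.
Qed.

Lemma gamma_density_ge0 a t : 0 <= gamma_density a t.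
Proof. by rewrite mulr_ge0// mulr_ge0// ?powR_ge0 ?expR_ge0. Qed.

Lemma measurable_gamma_density a : measurable_fun setT (gamma_density a).
Proof.
apply: measurable_funM => //.
apply: measurable_funM; first exact: measurable_powR.
by apply: measurableT_comp => //; exact: measurable_expR.
Qed.

Lemma measurable_EFin_gamma_density a :
  measurable_fun setT (fun t => (gamma_density a t)%:E).
Proof. by apply/measurable_EFinP; exact: measurable_gamma_density. Qed.

Lemma gamma_mass0 : gamma_mass 0 = 1%E.
Proof.
rewrite -(@integral_exponential_pdf R 1 ltr01); apply: eq_integral => t _.
congr EFin; rewrite /exponential_pdf patchE.
case: ifPn => [/set_mem/=|/negP].
  by rewrite in_itv/= andbT => t0; rewrite gamma_densityE// powRr0 mulN1r.
rewrite inE/= in_itv/= andbT => /negP; rewrite -ltNge => t0.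
by rewrite gamma_density_lt0.
Qed.

Lemma gamma_mass_ge0 a : (0 <= gamma_mass a)%E.
Proof. by apply: integral_ge0 => t _; rewrite lee_fin gamma_density_ge0. Qed.

Lemma gamma_mass_gt0 a : 0 <= a -> (0 < gamma_mass a)%E.
Proof.
move=> a0; pose D : set (measurableTypeR R) := `[1, 2]%classic.
apply: (@lt_le_trans _ _ (\int[leb]_(t in D) (cst (expR (- 2))%:E t))%E).
  rewrite integral_cst; last exact: measurable_itv.
  rewrite [X in (_ * X)%E]lebesgue_measure_itv/= lte_fin ltr1n -EFinB -EFinM.
  by rewrite lte_fin mulr_gt0 ?expR_gt0//; lra.
apply: (@le_trans _ _ (\int[leb]_(t in D) (gamma_density a t)%:E)%E).
  apply: ge0_le_integral => //.
  - exact: measurable_itv.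
  - by move=> t _; rewrite lee_fin expR_ge0.
  - by apply: measurable_funTS; exact: measurable_EFin_gamma_density.
  - move=> t; rewrite /D/= in_itv/= => /andP[t1 t2].
    rewrite lee_fin gamma_densityE; last lra.
    rewrite -[leLHS]mul1r ler_pM ?expR_ge0// ?ler_expR ?lerN2//.
    apply: (@le_trans _ _ (1 `^ a)); first by rewrite powR1.
    by apply: ge0_ler_powR; rewrite ?nnegrE//; lra.
apply: ge0_subset_integral => //; first exact: measurable_itv.
  exact: measurable_EFin_gamma_density.
by move=> t _; rewrite lee_fin gamma_density_ge0.
Qed.

(** The bound [1 + x <= expR x] at [x = t / (2 a)] gives
    [t ^ a <= (2 a) ^ a expR (t / 2)], so the density is dominated by a multiple
    of [expR (- t / 2)]. *)
Lemma gamma_mass_fin a : 0 <= a -> (gamma_mass a < +oo)%E.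
Proof.
move=> a0.
(* The [1] in the maximum takes care of [a = 0]. *)
pose C : R := Num.max 1 ((2 * a) `^ a).
have C0 : 0 < C by rewrite lt_max ltr01.
apply: (@le_lt_trans _ _
  (\int[leb]_t (C%:E * (gamma_density 0 (2^-1 * t + 0)%R)%:E))%E).
  apply: ge0_le_integral => //.
  - by move=> t _; rewrite lee_fin gamma_density_ge0.
  - exact: measurable_EFin_gamma_density.
  - apply: measurable_funeM; apply/measurable_EFinP.
    apply: (measurableT_comp (measurable_gamma_density 0)).
    by apply: measurable_funD => //; exact: measurable_funM.
  move=> t _; rewrite -EFinM lee_fin addr0.
  have [t0|t0] := ltP t 0.
    by rewrite gamma_density_lt0// mulr_ge0 ?gamma_density_ge0// ltW.
  rewrite !gamma_densityE//; last by rewrite mulr_ge0.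
  rewrite powRr0 mul1r -ler_pdivrMr ?expR_gt0// -mulrA -expRN -expRD.
  have -> : - t + - - (2^-1 * t) = - (2^-1 * t) by lra.
  rewrite expRN ler_pdivrMr ?expR_gt0// /C.
  have [a1|a1] := eqVneq a 0.
    rewrite a1 !powRr0 maxxx mul1r; have := expR_ge1Dx (2^-1 * t); lra.
  have {}a0 : 0 < a by rewrite lt_neqAle eq_sym a1.
  have -> : 2^-1 * t = (t / (2 * a)) * a by field.
  rewrite expRM maxC.
  apply: (@le_trans _ _ ((2 * a) `^ a * expR (t / (2 * a)) `^ a)).
    have a20 : 0 <= 2 * a by lra.
    rewrite -powRM ?expR_ge0//.
    apply: ge0_ler_powR; rewrite ?nnegrE; [exact: ltW|exact: t0| |].
      by rewrite mulr_ge0 ?expR_ge0.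
    rewrite mulrC -ler_pdivrMr ?mulr_gt0//.
    by have := expR_ge1Dx (t / (2 * a)); lra.
  by rewrite ler_wpM2r ?powR_ge0// le_max lexx.
rewrite ge0_integralZl//; last 3 first.
- apply/measurable_EFinP.
  apply: (measurableT_comp (measurable_gamma_density 0)).
  by apply: measurable_funD => //; exact: measurable_funM.
- by move=> t _; rewrite lee_fin gamma_density_ge0.
- by rewrite lee_fin ltW.
rewrite (@ge0_integral_affine _ _ _ (fun t => (gamma_density 0 t)%:E))
  ?invr_gt0//.
- by rewrite -/(gamma_mass 0) gamma_mass0 mule1 invrK -EFinM ltry.
- exact: measurable_EFin_gamma_density.
- by move=> t; rewrite lee_fin gamma_density_ge0.
Qed.

Lemma Gamma_gamma_mass a : Gamma (a + 1) = fine (gamma_mass a).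
Proof.
rewrite /Gamma /Rintegral addrK; congr fine.
transitivity (\int[leb]_(x in `]0%R, +oo[) (gamma_density a x)%:E)%E.
  apply: eq_integral => t; rewrite inE/= in_itv/= andbT => t0.
  by rewrite gamma_densityE// ltW.
rewrite integral_itv_obnd_cbnd; last first.
  by apply: measurable_funTS; exact: measurable_EFin_gamma_density.
rewrite integral_mkcond; apply: eq_integral => t _.
rewrite patchE; case: ifPn => // /negP.
rewrite inE/= in_itv/= andbT => /negP; rewrite -ltNge => t0.
by rewrite gamma_density_lt0.
Qed.

End gamma_density.

Lemma ge0_integral_itv_split (R : realType)
    (m : {measure set (measurableTypeR R) -> \bar R})
    (f : measurableTypeR R -> \bar R) (x : nat -> R) N :
  (forall k, x k <= x k.+1) ->
  measurable_fun setT f -> (forall y, 0 <= f y)%E ->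
  (\int[m]_(y in `](x 0%N), (x N)]%classic) f y =
   \sum_(k < N) \int[m]_(y in `](x k), (x k.+1)]%classic) f y)%E.
Proof.
move=> xS mf f0; elim: N => [|N IH].
  by rewrite big_ord0 set_itvoc0 integral_set0.
rewrite big_ord_recr/= -IH -ge0_integral_setU//.
- congr (integral _ _ _); rewrite -itv_bndbnd_setU// bnd_simp//.
  by elim: N {IH} => // N IH; exact: le_trans IH (xS N).
- exact: measurable_funTS.
- apply/disj_setPS => y [] /=; rewrite !in_itv/= => /andP[_ yN] /andP[Ny _].
  by move: (le_lt_trans yN Ny); rewrite ltxx.
Qed.

Definition powR_measure_exp (R : realType) (a : R) (a0 : 0 < a) : \bar R :=
  (\int[powR_measure a0]_x
    (\1_(`]0, +oo[%classic : set (measurableTypeR R)) x * expR (- x))%:E)%E.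

Section beta_sums.
Variables (R : realType) (a b : R) (a0 : 0 < a) (b0 : 0 <= b).
Local Notation leb := (@lebesgue_measure R).
Local Notation nu := (@powR_measure R a a0).
Local Notation TR := (measurableTypeR R).

Let positives : set TR := `]0, +oo[%classic.

Local Notation exp_mass := (powR_measure_exp a0).

(** At [(t, x)] with [0 < x <= t] this is [(t - x) ^ b expR (- t)]; the factored
    form shows that its integral in [t] splits. *)
Let kernel (z : TR * TR) : R :=
  \1_positives z.2 * expR (- z.2) * gamma_density b (z.1 - z.2).

Let kernel_ge0 z : 0 <= kernel z.
Proof. by rewrite mulr_ge0 ?gamma_density_ge0// mulr_ge0 ?expR_ge0. Qed.

Let mpositives : measurable positives. Proof. exact: measurable_itv. Qed.

Let mexp : measurable_fun setT (fun x : TR => \1_positives x * expR (- x)).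
Proof.
apply: measurable_funM => //.
by apply: measurableT_comp => //; exact: measurable_expR.
Qed.

Let measurable_kernel : measurable_fun setT (EFin \o kernel).
Proof.
apply/measurable_EFinP; apply: measurable_funM.
  exact: (measurableT_comp mexp measurable_snd).
apply: (measurableT_comp (@measurable_gamma_density R b)).
by apply: measurable_funB; [exact: measurable_fst|exact: measurable_snd].
Qed.

Let kernel_integral :
  (\int[leb]_t \int[nu]_x (kernel (t, x))%:E = exp_mass * gamma_mass b)%E.
Proof.
rewrite (fubini_tonelli (EFin \o kernel))//=.
transitivity (\int[nu]_x ((\1_positives x * expR (- x))%:E * gamma_mass b))%E.
  apply: eq_integral => x _ /=.
  transitivity (\int[leb]_t ((\1_positives x * expR (- x))%:E *
      (gamma_density b (1 * t + - x)%R)%:E))%E.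
    by apply: eq_integral => t _; rewrite -EFinM mul1r.
  rewrite ge0_integralZl//.
  - rewrite (@ge0_integral_affine _ _ _ (fun t => (gamma_density b t)%:E))//.
    + by rewrite invr1 mul1e.
    + exact: measurable_EFin_gamma_density.
    + by move=> t; rewrite lee_fin gamma_density_ge0.
  - apply/measurable_EFinP.
    apply: (measurableT_comp (measurable_gamma_density b)).
    by apply: measurable_funD => //; exact: measurable_funM.
  - by move=> t _; rewrite lee_fin gamma_density_ge0.
rewrite ge0_integralZr//.
- exact/measurable_EFinP.
- exact: gamma_mass_ge0.
Qed.

Let kernel_section t : 0 <= t ->
  (\int[nu]_x (kernel (t, x))%:E =
   \int[nu]_(x in `]0%R, t]%classic) ((t - x) `^ b * expR (- t))%:E)%E.
Proof.
move=> t0; rewrite [RHS]integral_mkcond; apply: eq_integral => x _.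
rewrite patchE; case: ifPn => [/set_mem/=|/negP].
  rewrite in_itv/= => /andP[x0 xt]; rewrite /kernel/=.
  rewrite indicE mem_set/=; last by rewrite /positives/= in_itv/= x0.
  rewrite mul1r gamma_densityE ?subr_ge0// mulrCA -expRD.
  by congr (_ * expR _)%:E; lra.
rewrite inE/= in_itv/= => /negP; rewrite negb_and -leNgt -ltNge => /orP[x0|tx].
  rewrite /kernel/= indicE memNset ?mul0r// /positives/= in_itv/= andbT.
  by apply/negP; rewrite -leNgt.
by rewrite /kernel/= gamma_density_lt0 ?mulr0// subr_lt0.
Qed.

(** The integrand decreases on [D], so it lies between its values at the two
    ends. *)
Let piece t x y (D := `]x, y]%classic : set TR) : 0 <= x <= y -> y <= t ->
  (((t - y) `^ b * expR (- t) * (y `^ a - x `^ a))%:E <=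
    \int[nu]_(s in D) ((t - s) `^ b * expR (- t))%:E <=
   ((t - x) `^ b * expR (- t) * (y `^ a - x `^ a))%:E)%E.
Proof.
move=> /[dup] xy /andP[x0 xley] yt.
have mD : measurable D by exact: measurable_itv.
have cstE c : (\int[nu]_(s in D) (cst c%:E s) = (c * (y `^ a - x `^ a))%:E)%E.
  by rewrite integral_cst// [X in (_ * X)%E]powR_measure_itv// -EFinM.
have mf : measurable_fun D (fun s : TR => ((t - s) `^ b * expR (- t))%:E).
  apply: measurable_funTS; apply/measurable_EFinP.
  apply: measurable_funM => //.
  apply: (measurableT_comp (@measurable_powR R b)).
  exact: measurable_funB.
rewrite -!cstE; apply/andP; split; apply: ge0_le_integral => //.
- by move=> s _; rewrite lee_fin mulr_ge0 ?powR_ge0 ?expR_ge0.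
- move=> s; rewrite /D/= in_itv/= => /andP[xs sy].
  rewrite lee_fin ler_wpM2r ?expR_ge0//; apply: ge0_ler_powR => //.
  + by rewrite nnegrE subr_ge0.
  + by rewrite nnegrE subr_ge0 (le_trans sy).
  + by rewrite lerB.
- by move=> s _; rewrite lee_fin mulr_ge0 ?powR_ge0 ?expR_ge0.
- move=> s; rewrite /D/= in_itv/= => /andP[xs sy].
  rewrite lee_fin ler_wpM2r ?expR_ge0//; apply: ge0_ler_powR => //.
  + by rewrite nnegrE subr_ge0 (le_trans sy).
  + by rewrite nnegrE subr_ge0 (le_trans _ yt).
  + by rewrite lerB// ltW.
Qed.

Variables (N : nat) (u : nat -> R).
Hypotheses (u0 : u 0%N = 0) (uN : u N = 1) (uS : forall k, u k <= u k.+1).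

(** A Stieltjes sum for the integral of [(1 - x) ^ b d(x ^ a)] over [[0, 1]],
    upper for [c k = (1 - u k) ^ b] and lower for [c k = (1 - u k.+1) ^ b]. *)
Definition beta_sum (c : nat -> R) : R :=
  \sum_(k < N) c k * (u k.+1 `^ a - u k `^ a).

Let u_ge0 k : 0 <= u k.
Proof. by elim: k => [|k IH]; rewrite ?u0//; exact: le_trans (uS k). Qed.

Let u_le1 k : (k <= N)%N -> u k <= 1.
Proof.
move=> kN; rewrite -uN; elim: N kN => [|M IH].
  by rewrite leqn0 => /eqP ->.
by rewrite leq_eqVlt => /orP[/eqP ->//|/IH]; move/le_trans; exact.
Qed.

(** Splitting [[0, t]] at the points [t u_k] makes the bound on each piece
    homogeneous in [t]: all the dependence on [t] is a factor [t ^ (a + b)]. *)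
Let kernel_bounds t :
  ((beta_sum (fun k => (1 - u k.+1) `^ b) * gamma_density (a + b) t)%:E <=
    \int[nu]_x (kernel (t, x))%:E <=
   (beta_sum (fun k => (1 - u k) `^ b) * gamma_density (a + b) t)%:E)%E.
Proof.
have [t0|t0] := ltP t 0.
  rewrite gamma_density_lt0// !mulr0 integral0_eq ?lexx// => x _.
  rewrite /kernel/= indicE; have [/set_mem/=|] := boolP (x \in positives).
    rewrite /positives/= in_itv/= andbT => x0.
    by rewrite gamma_density_lt0 ?mulr0// (lt_trans _ t0)// ltrBlDr ltrDl.
  by rewrite !mul0r.
rewrite kernel_section// gamma_densityE//.
have -> : `]0, t]%classic = `](t * u 0%N), (t * u N)]%classic.
  by rewrite u0 uN mulr0 mulr1.
rewrite (@ge0_integral_itv_split R nu _ (fun k => t * u k) N); last 3 first.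
- by move=> k; rewrite ler_wpM2l.
- apply/measurable_EFinP; apply: measurable_funM => //.
  by apply: (measurableT_comp (@measurable_powR R b)); exact: measurable_funB.
- by move=> y; rewrite lee_fin mulr_ge0 ?powR_ge0 ?expR_ge0.
have termE k c : (k < N)%N -> 0 <= 1 - c ->
    (1 - c) `^ b * (u k.+1 `^ a - u k `^ a) * (t `^ (a + b) * expR (- t)) =
    (t - t * c) `^ b * expR (- t) * ((t * u k.+1) `^ a - (t * u k) `^ a).
  move=> kN c1; have -> : t - t * c = t * (1 - c) by ring.
  rewrite !powRM//.
  rewrite powRD; last by rewrite gt_eqF// ltr_wpDr.
  by ring.
have bnd (k : 'I_N) := @piece t (t * u k) (t * u k.+1).
have bnd1 k : 0 <= t * u k <= t * u k.+1 by rewrite mulr_ge0//= ler_wpM2l.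
have bnd2 (k : 'I_N) : t * u k.+1 <= t by rewrite ler_piMr// u_le1.
rewrite /beta_sum !mulr_suml -!sumEFin.
apply/andP; split; apply: lee_sum => k _.
  rewrite termE//; last by rewrite subr_ge0 u_le1.
  by have /andP[] := bnd k (bnd1 k) (bnd2 k).
rewrite termE//; last by rewrite subr_ge0 u_le1// ltnW.
by have /andP[] := bnd k (bnd1 k) (bnd2 k).
Qed.

Let beta_sum_ge0 c : (forall k, 0 <= c k) -> 0 <= beta_sum c.
Proof.
move=> c0; apply: sumr_ge0 => k _; rewrite mulr_ge0// subr_ge0.
by apply: ge0_ler_powR; rewrite ?nnegrE// ltW.
Qed.

(** Integrating [kernel_bounds] in [t], and evaluating the middle term with the
    integrals in the other order. *)
Lemma gamma_mass_bounds :
  ((beta_sum (fun k => (1 - u k.+1) `^ b))%:E * gamma_mass (a + b) <=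
    exp_mass * gamma_mass b <=
   (beta_sum (fun k => (1 - u k) `^ b))%:E * gamma_mass (a + b))%E.
Proof.
have mkernel : measurable_fun setT
    (fun t : TR => \int[nu]_x (kernel (t, x))%:E)%E.
  exact: (measurable_fun_fubini_tonelli_F _ measurable_kernel).
have mgd c :
    measurable_fun setT (fun t : TR => (c * gamma_density (a + b) t)%:E).
  apply/measurable_EFinP; apply: measurable_funM => //.
  exact: measurable_gamma_density.
have gmE c : 0 <= c -> (c%:E * gamma_mass (a + b) =
    \int[leb]_t (c * gamma_density (a + b) t)%:E)%E.
  move=> c0; rewrite -ge0_integralZl//.
    exact: measurable_EFin_gamma_density.
  by move=> t _; rewrite lee_fin gamma_density_ge0.
rewrite !gmE -?kernel_integral; last 2 first.
- by apply: beta_sum_ge0 => k; exact: powR_ge0.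
- by apply: beta_sum_ge0 => k; exact: powR_ge0.
apply/andP; split; apply: ge0_le_integral => //.
- move=> t _; rewrite lee_fin mulr_ge0 ?gamma_density_ge0//.
  by apply: beta_sum_ge0 => k; exact: powR_ge0.
- by move=> t _; have /andP[] := kernel_bounds t.
- by move=> t _; apply: integral_ge0 => x _; rewrite lee_fin.
- by move=> t _; have /andP[] := kernel_bounds t.
Qed.

End beta_sums.

(** This is an integration by parts; it comes out of [gamma_mass_bounds] for
    [b = 0] and a single interval, where both sums are [1]. *)
Lemma powR_measure_expE (R : realType) (a : R) (a0 : 0 < a) :
  powR_measure_exp a0 = gamma_mass a.
Proof.
pose u k : R := (k != 0%N)%:R.
have uS k : u k <= u k.+1 by rewrite /u/= ler_nat leq_b1.
have /andP[] := @gamma_mass_bounds R a 0 a0 (lexx 0) 1 u erefl erefl uS.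
have E c : (forall k, c k = 1) -> beta_sum a 1 u c = 1.
  move=> c1; rewrite /beta_sum big_ord1 c1/= /u/= powR1 powR0 ?gt_eqF//.
  by rewrite subr0 mulr1.
rewrite !E; last 2 first.
- by move=> k; rewrite powRr0.
- by move=> k; rewrite powRr0.
rewrite addr0 gamma_mass0 mule1 !mul1e => h1 h2.
by apply: le_anti; apply/andP; split; [exact: h2|exact: h1].
Qed.

(** The middle term is the value that Euler found for the beta integral
    [int_0^1 (1 - x) ^ b d(x ^ a)]; every subdivision brackets it. *)
Lemma beta_sum_bounds (R : realType) (a b : R) (N : nat) (u : nat -> R) :
  0 < a -> 0 <= b -> u 0%N = 0 -> u N = 1 -> (forall k, u k <= u k.+1) ->
  beta_sum a N u (fun k => (1 - u k.+1) `^ b) <=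
    Gamma (a + 1) * Gamma (b + 1) / Gamma (a + b + 1) <=
  beta_sum a N u (fun k => (1 - u k) `^ b).
Proof.
move=> a0 b0 u0 uN uS.
have := gamma_mass_bounds a0 b0 u0 uN uS.
have fin (c : R) : 0 <= c -> gamma_mass c \is a fin_num :> bool.
  by move=> c0; rewrite ge0_fin_numE ?gamma_mass_ge0 ?gamma_mass_fin.
have ab0 : 0 <= a + b by rewrite addr_ge0// ltW.
rewrite powR_measure_expE !Gamma_gamma_mass.
rewrite -(fineK (fin _ (ltW a0))) -(fineK (fin _ b0)) -(fineK (fin _ ab0)).
rewrite -!EFinM !lee_fin /= ler_pdivlMr ?ler_pdivrMr//.
all: by rewrite fine_gt0// gamma_mass_gt0// gamma_mass_fin.
Qed.

(** * Upper and lower sums for the constant *)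

(** Bounding all increments of [x ^ a] by [d] leaves a telescoping sum of the
    increments of [(1 - x) ^ b], which is at most [1]. *)
Lemma beta_sum_gap (R : realType) (a b : R) (N : nat) (u : nat -> R) (d : R) :
  0 <= b -> u 0%N = 0 -> u N = 1 -> (forall k, u k <= u k.+1) ->
  (forall k, (k < N)%N -> u k.+1 `^ a - u k `^ a <= d) -> 0 <= d ->
  beta_sum a N u (fun k => (1 - u k) `^ b) -
    beta_sum a N u (fun k => (1 - u k.+1) `^ b) <= d.
Proof.
move=> b0 u0 uN uS ud d0.
have u_le1 k : (k <= N)%N -> u k <= 1.
  move=> kN; rewrite -uN -(subnK kN).
  by elim: (N - k)%N => // m IH; rewrite addSn; exact: le_trans (uS _).
rewrite /beta_sum -sumrB.
apply: (@le_trans _ _ (\sum_(k < N) ((1 - u k) `^ b - (1 - u k.+1) `^ b) * d)).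
  apply: ler_sum => k _; rewrite -mulrBl ler_wpM2l ?ud//.
  rewrite subr_ge0; apply: ge0_ler_powR; rewrite ?nnegrE ?subr_ge0 ?lerB//.
  - exact: u_le1.
  - by apply: u_le1; exact: ltnW.
rewrite -mulr_suml.
have -> : \sum_(k < N) ((1 - u k) `^ b - (1 - u k.+1) `^ b) =
    (1 - u 0%N) `^ b - (1 - u N) `^ b.
  elim: N {ud uN u_le1} => [|N IH]; first by rewrite big_ord0 subrr.
  by rewrite big_ord_recr/= IH; ring.
by rewrite u0 uN subr0 powR1 ler_piMl// lerBlDr lerDl powR_ge0.
Qed.

Lemma exprB_le (R : realDomainType) (x y : R) i :
  0 <= y -> y <= x -> x <= 1 -> x ^+ i - y ^+ i <= i%:R * (x - y).
Proof.
move=> y0 yx x1; elim: i => [|i IH]; first by rewrite !expr0 subrr mul0r.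
have yi0 : 0 <= y ^+ i by exact: exprn_ge0.
have yi1 : y ^+ i <= 1 by apply: exprn_ile1 => //; exact: le_trans x1.
have yxi : y ^+ i <= x ^+ i by apply: lerXn2r; rewrite ?nnegrE// (le_trans y0).
rewrite !exprS -natr1; nra.
Qed.

Section kappa_sums.
Variables (R : realType) (r : R) (r0 : 0 < r) (N : nat) (N0 : (0 < N)%N).

(** The points [(curve_s k, curve_t k)] lie on the curve [s ^ q + t ^ q = 1],
    where [r^-1 = q].  They are equidistant in [s], and not in [s ^ q], because
    the increments of the powers [s ^ i] must then be [O(1 / N)]. *)
Definition curve_s (k : nat) : R := k%:R / N%:R.
Definition curve_t (k : nat) : R := (1 - curve_s k `^ r^-1) `^ r.

Lemma curve_s0 : curve_s 0 = 0. Proof. by rewrite /curve_s mul0r. Qed.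

Lemma curve_sN : curve_s N = 1.
Proof. by rewrite /curve_s divff// pnatr_eq0 -lt0n. Qed.

Lemma curve_s_ge0 k : 0 <= curve_s k.
Proof. by rewrite /curve_s mulr_ge0// invr_ge0. Qed.

Lemma curve_sS k : curve_s k.+1 = curve_s k + N%:R^-1.
Proof. by rewrite /curve_s -natr1 mulrDl mul1r. Qed.

Lemma curve_s_le k l : (k <= l)%N -> curve_s k <= curve_s l.
Proof. by move=> kl; rewrite ler_wpM2r ?invr_ge0// ler_nat. Qed.

Lemma curve_t_ge0 k : 0 <= curve_t k. Proof. exact: powR_ge0. Qed.

Lemma curve_t0 : curve_t 0 = 1.
Proof. by rewrite /curve_t curve_s0 powR0 ?subr0 ?powR1// invr_eq0 gt_eqF. Qed.

Let u k := curve_s k `^ r^-1.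

Let u0 : u 0 = 0. Proof. by rewrite /u curve_s0 powR0// invr_eq0 gt_eqF. Qed.

Let uN : u N = 1. Proof. by rewrite /u curve_sN powR1. Qed.

Let u_le k l : (k <= l)%N -> u k <= u l.
Proof.
move=> kl; have r0' : 0 <= r^-1 by rewrite invr_ge0 ltW.
by apply: ge0_ler_powR; rewrite ?nnegrE ?curve_s_ge0 ?curve_s_le.
Qed.

Let uS k : u k <= u k.+1. Proof. exact: u_le. Qed.

Lemma curve_t_le k l : (k <= l <= N)%N -> curve_t l <= curve_t k.
Proof.
move=> /andP[kl lN]; apply: ge0_ler_powR; rewrite ?nnegrE ?subr_ge0.
- exact: ltW.
- by rewrite -uN; exact: u_le.
- by rewrite -uN; apply: u_le; exact: leq_trans lN.
- by rewrite lerB//; exact: u_le.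
Qed.

Let uX i k : u k `^ (i%:R * r) = curve_s k ^+ i.
Proof.
rewrite /u -powRrM -(powR_mulrn i (curve_s_ge0 k)); congr (_ `^ _).
by rewrite mulrCA mulVf ?mulr1// gt_eqF.
Qed.

Let tX i k : curve_t k ^+ i = (1 - u k) `^ (i%:R * r).
Proof. by rewrite -(powR_mulrn i (curve_t_ge0 k)) -powRrM mulrC. Qed.

Lemma exprDB (x y t : R) n :
  (x + t) ^+ n - (y + t) ^+ n =
  \sum_(i < n) 'C(n, i.+1)%:R * (t ^+ (n - i.+1) * (x ^+ i.+1 - y ^+ i.+1)).
Proof.
rewrite ![_ + t]addrC !exprDn -sumrB big_ord_recl/= !expr0 subrr add0r.
apply: eq_bigr => i _; rewrite /bump/= add1n -mulrnBl -mulrBr -[LHS]mulr_natl.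
by [].
Qed.

(** The factor by which [|Z|] is multiplied in the estimates of the volume of
    the union: upper for [t = curve_t], lower for [t k = curve_t k.+1].  The [1]
    is the contribution of the first body, [- Z]. *)
Definition volume_sum n (t : nat -> R) : R :=
  1 + \sum_(k < N) ((curve_s k.+1 + t k) ^+ n - (curve_s k + t k) ^+ n).

(** With [u k = s_k ^ q], the powers [s_k ^ i] and [t_k ^ j] are [u_k ^ (i r)]
    and [(1 - u_k) ^ (j r)], so that one subdivision serves all the beta
    integrals at once. *)
Let volume_sumE n (t c : nat -> R) :
  (forall i k, t k ^+ i = c k `^ (i%:R * r)) ->
  volume_sum n t = 1 + \sum_(i < n) 'C(n, i.+1)%:R *
    beta_sum (i.+1%:R * r) N u (fun k => c k `^ ((n - i.+1)%:R * r)).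
Proof.
move=> tc; congr (_ + _); under eq_bigr => k _ do rewrite exprDB.
rewrite exchange_big/=; apply: eq_bigr => i _.
rewrite -mulr_sumr; congr (_ * _); apply: eq_bigr => k _.
by rewrite !uX tc.
Qed.

Let Gamma1 : Gamma (0 + 1 : R) = 1.
Proof. by rewrite Gamma_gamma_mass gamma_mass0. Qed.

Let Gamma_gt0 (c : R) : 0 <= c -> 0 < Gamma (c + 1).
Proof.
move=> c0.
by rewrite Gamma_gamma_mass fine_gt0// gamma_mass_gt0 ?gamma_mass_fin.
Qed.

(** [kappa_s] in terms of [r = 1 / q], which is a real number also for
    [q = +oo]. *)
Definition kappa n : R :=
  \sum_(i < n.+1) 'C(n, i)%:R / binomR (n%:R * r) (i%:R * r).

Let kappaE n : kappa n = 1 + \sum_(i < n) 'C(n, i.+1)%:R *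
  (Gamma (i.+1%:R * r + 1) * Gamma ((n - i.+1)%:R * r + 1) /
     Gamma (i.+1%:R * r + (n - i.+1)%:R * r + 1)).
Proof.
have nr0 : 0 <= n%:R * r by rewrite mulr_ge0// ltW.
rewrite /kappa big_ord_recl/= bin0 mul0r /binomR Gamma1 mul1r subr0.
rewrite divff; last by rewrite (gt_eqF (Gamma_gt0 nr0)).
rewrite divr1; congr (_ + _).
apply: eq_bigr => i _; rewrite /bump/= add1n; congr (_ * _).
have -> : (n - i.+1)%:R * r = n%:R * r - i.+1%:R * r by rewrite natrB// mulrBl.
by rewrite invf_div subrKC.
Qed.

Lemma kappa_bounds n :
  volume_sum n (fun k => curve_t k.+1) <= kappa n <= volume_sum n curve_t.
Proof.
rewrite kappaE.
have ir0 (i : 'I_n) : 0 < i.+1%:R * r by rewrite mulr_gt0.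
have nir0 (i : 'I_n) : 0 <= (n - i.+1)%:R * r by rewrite mulr_ge0// ltW.
have bnd (i : 'I_n) := beta_sum_bounds (ir0 i) (nir0 i) u0 uN uS.
apply/andP; split.
  rewrite (volume_sumE n (fun i k => tX i k.+1)) lerD2l.
  by apply: ler_sum => i _; rewrite ler_wpM2l//; have /andP[] := bnd i.
rewrite (volume_sumE n tX) lerD2l.
by apply: ler_sum => i _; rewrite ler_wpM2l//; have /andP[] := bnd i.
Qed.

Lemma volume_sum_gap n : volume_sum n curve_t <=
  volume_sum n (fun k => curve_t k.+1) +
  (\sum_(i < n) 'C(n, i.+1)%:R * i.+1%:R) / N%:R.
Proof.
rewrite [leLHS](volume_sumE n tX).
rewrite [X in _ <= X + _](volume_sumE n (fun i k => tX i k.+1)).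
rewrite -addrA lerD2l -lerBlDl -sumrB mulr_suml; apply: ler_sum => i _.
rewrite -mulrBr -mulrA ler_wpM2l//; apply: beta_sum_gap => //.
- by rewrite mulr_ge0// ltW.
- move=> k kN; rewrite !uX.
  apply: le_trans (exprB_le _ (curve_s_ge0 k) _ _) _.
  + exact: curve_s_le.
  + by rewrite -curve_sN; exact: curve_s_le.
  + by rewrite curve_sS addrAC subrr add0r.
Qed.

End kappa_sums.

(** * Support functions and separation *)

Section support_functions.
Variables (R : realType) (n : nat).
Implicit Types (x y z : 'rV[R]_n) (K M : set 'rV[R]_n).

Definition is_convex K := forall x y (t : R), 0 <= t <= 1 ->
  K x -> K y -> K ((1 - t) *: x + t *: y).

Lemma convex_setP K :
  convex_set (K : set (convex_lmodType 'rV[R]_n)) <-> is_convex K.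
Proof.
split => [cK x y t /andP[t0 t1] Kx Ky|cK x y l].
  have := cK y x (Itv01 t0 t1); rewrite !inE => /(_ Ky Kx) h.
  by rewrite addrC; exact: h.
rewrite !inE => Kx Ky; have := cK y x l%:num.
by rewrite ge0 le1 addrC => h; exact: h.
Qed.

Lemma dotvDr x y z : dotv x (y + z) = dotv x y + dotv x z.
Proof. by rewrite -big_split; apply: eq_bigr => i _; rewrite mxE mulrDr. Qed.

Lemma dotvZr x (c : R) y : dotv x (c *: y) = c * dotv x y.
Proof. by rewrite mulr_sumr; apply: eq_bigr => i _; rewrite mxE mulrCA. Qed.

Lemma dotvC x y : dotv x y = dotv y x.
Proof. by apply: eq_bigr => i _; rewrite mulrC. Qed.

Lemma dotvNr x y : dotv x (- y) = - dotv x y.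
Proof. by rewrite -scaleN1r dotvZr mulN1r. Qed.

Lemma dotvBr x y z : dotv x (y - z) = dotv x y - dotv x z.
Proof. by rewrite dotvDr dotvNr. Qed.

Lemma dotv_sqrBZ x y (t : R) :
  dotv (x - t *: y) (x - t *: y) = dotv x x - t * (dotv x y * 2 - t * dotv y y).
Proof.
rewrite dotvBr dotvZr ![dotv (_ - _) _]dotvC !dotvBr !dotvZr (dotvC y x).
by ring.
Qed.

Lemma dotvv_ge0 x : 0 <= dotv x x.
Proof. by apply: sumr_ge0 => i _; rewrite -expr2 sqr_ge0. Qed.

Lemma dotvv_eq0 x : dotv x x = 0 -> x = 0.
Proof.
move=> /eqP; rewrite psumr_eq0; last by move=> i _; rewrite -expr2 sqr_ge0.
move=> /allP x0; apply/rowP => i; rewrite mxE.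
have /implyP/(_ isT) := x0 i (mem_index_enum _).
by rewrite mulf_eq0 orbb => /eqP.
Qed.

Lemma dotv_continuous (T : topologicalType) (f g : T -> 'rV[R]_n) :
  continuous f -> continuous g -> continuous (fun u => dotv (f u) (g u)).
Proof.
move=> cf cg u.
have cterm i : (f v 0 i * g v 0 i) @[v --> u] --> f u 0 i * g u 0 i.
  apply: cvgM.
    exact: (@continuous_comp _ _ _ f (fun v : 'rV[R]_n => v 0 i) u (cf u)
      (@coord_continuous _ _ _ _ _ _)).
  exact: (@continuous_comp _ _ _ g (fun v : 'rV[R]_n => v 0 i) u (cg u)
    (@coord_continuous _ _ _ _ _ _)).
rewrite /dotv /continuous_at; elim: (index_enum _) => [|i s IH].
  under eq_fun do rewrite big_nil.
  by rewrite big_nil; exact: cvg_cst.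
under eq_fun do rewrite big_cons.
by rewrite big_cons; apply: cvgD.
Qed.

Lemma support_funE K x (v : R) :
  (forall k, K k -> dotv x k <= v) -> (exists2 k, K k & dotv x k = v) ->
  support_fun K x = v.
Proof.
move=> Kv [k Kk kv]; apply/eqP; rewrite eq_le; apply/andP; split.
  apply: ge_sup; first by exists (dotv x k), k.
  by move=> _ [y Ky <-]; exact: Kv.
rewrite -kv; apply: ub_le_sup; last by exists k.
by exists v => _ [y Ky <-]; exact: Kv.
Qed.

Lemma support_fun_max K x : K !=set0 -> compact K ->
  exists2 k, K k & support_fun K x = dotv x k /\
                   forall y, K y -> dotv x y <= dotv x k.
Proof.
move=> K0 cK.
have [|k] := @EVT_max_rV R n (dotv x) K K0 cK.
  apply: continuous_subspaceT => //.
  apply: (@dotv_continuous _ (fun=> x) (fun y => y)).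
    exact: cst_continuous.
  by move=> y; apply: cvg_id.
rewrite inE => Kk kmax; exists k => //.
have kmax' y : K y -> dotv x y <= dotv x k.
  by move=> Ky; apply: kmax; rewrite inE.
by split => //; apply: support_funE => //; exists k.
Qed.

Lemma le_support_fun K x y : compact K -> K y -> dotv x y <= support_fun K x.
Proof.
move=> cK Ky; have [|k Kk [-> kmax]] := @support_fun_max K x _ cK.
  by exists y.
exact: kmax.
Qed.

(** If [y] is the point of [M] nearest to [x], then no point of [M] lies beyond
    [y] in the direction [d = x - y], because moving from [y] towards such a
    point would decrease the distance to [x]. *)
Lemma nearest_point_separates M x : M !=set0 -> compact M -> is_convex M ->
  ~ M x -> exists d, support_fun M d < dotv d x.
Proof.
move=> M0 cM coM Mx.
have [|y] := @EVT_min_rV R n (fun y => dotv (x - y) (x - y)) M M0 cM.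
  apply: continuous_subspaceT => //.
  have cB : continuous (fun y => x - y).
    by move=> y; apply: continuousB; [exact: cst_continuous|apply: cvg_id].
  exact: dotv_continuous.
rewrite inE => My ymin; exists (x - y).
have d0 : 0 < dotv (x - y) (x - y).
  rewrite lt_neqAle dotvv_ge0 andbT eq_sym; apply/eqP => /dotvv_eq0/eqP.
  by rewrite subr_eq0 => /eqP xy; apply: Mx; rewrite xy.
have [z Mz [-> _]] := @support_fun_max M (x - y) M0 cM.
suff : dotv (x - y) (z - y) <= 0.
  rewrite dotvBr subr_le0 => h; apply: (le_lt_trans h).
  by rewrite -subr_gt0 -dotvBr.
set d := x - y in d0 *; set e := z - y.
have key (t : R) : 0 < t -> t <= 1 -> dotv d e * 2 <= t * dotv e e.
  move=> t0 t1.
  have /ymin : (1 - t) *: y + t *: z \in M.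
    by rewrite inE; apply: coM => //; rewrite ltW.
  have -> : x - ((1 - t) *: y + t *: z) = d - t *: e.
    by rewrite /d /e; apply/rowP => i; rewrite !mxE; ring.
  rewrite dotv_sqrBZ -/d => h.
  have : t * (dotv d e * 2) <= t * (t * dotv e e) by lra.
  by rewrite ler_pM2l.
rewrite leNgt; apply/negP => de0.
have ee0 := dotvv_ge0 e.
(* A step [t <= 1] towards [z] with [t * dotv e e < dotv d e]. *)
pose t := dotv d e / (dotv e e + dotv d e).
have den0 : 0 < dotv e e + dotv d e by rewrite ltr_wpDl.
have t0 : 0 < t by rewrite divr_gt0.
have t1 : t <= 1 by rewrite ler_pdivrMr// mul1r lerDr.
have := key t t0 t1; rewrite leNgt => /negP; apply.
rewrite /t mulrAC ltr_pdivrMr//; nra.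
Qed.

(** A point of [M1] outside [M2] would be separated from [M2] by some [d], and
    then the support functions would differ at [d]. *)
Lemma support_fun_inj M1 M2 : M1 !=set0 -> compact M1 ->
  M2 !=set0 -> compact M2 -> is_convex M2 ->
  (forall x, support_fun M1 x = support_fun M2 x) -> M1 `<=` M2.
Proof.
move=> M10 cM1 M20 cM2 coM2 h x M1x; apply: contrapT => M2x.
have [d] := nearest_point_separates M20 cM2 coM2 M2x.
by rewrite -h ltNge le_support_fun.
Qed.

End support_functions.

(** * The Lp sum as a union of scaled difference bodies *)

Section powR_inequalities.
Variable R : realType.
Implicit Types (a b p r l : R).

(** The convexity of [x ^ (1 / r)] applied to [x ^ r] and [y ^ r]. *)
Lemma concave_powR r (x y t : R) : 0 < r <= 1 -> 0 <= t <= 1 ->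
  0 <= x -> 0 <= y ->
  (1 - t) * x `^ r + t * y `^ r <= ((1 - t) * x + t * y) `^ r.
Proof.
move=> /andP[r0 r1] /andP[t0 t1] x0 y0.
have r1' : 1 <= r^-1 by rewrite invf_ge1.
have rK z : 0 <= z -> (z `^ r) `^ r^-1 = z.
  by move=> z0; rewrite -powRrM divff ?powRr1// gt_eqF.
have := @convex_powR R r^-1 r1' (Itv01 t0 t1) (y `^ r) (x `^ r).
rewrite !inE/= !in_itv/= !andbT !powR_ge0 => /(_ isT isT).
rewrite ![_ (Itv01 _ _) _ _]addrC/= !rK//.
set v := (X in X `^ r^-1 <= _) => h.
have v0 : 0 <= v by rewrite addr_ge0// mulr_ge0 ?powR_ge0// subr_ge0.
rewrite -[leLHS](@powRr1 R _ v0) -[X in v `^ X](mulVf (lt0r_neq0 r0)) powRrM.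
apply: ge0_ler_powR; rewrite ?nnegrE ?powR_ge0 ?(ltW r0)//.
exact: le_trans (powR_ge0 v r^-1) h.
Qed.

(** Hoelder's inequality for two terms: for the exponent [q] conjugate to [p],
    the [q]-th powers of the two coefficients add up to [1]. *)
Lemma lp_norm_ge p l a b : 1 <= p -> 0 <= l <= 1 -> 0 <= a -> 0 <= b ->
  (1 - l) `^ (1 - p^-1) * a + l `^ (1 - p^-1) * b <= (a `^ p + b `^ p) `^ p^-1.
Proof.
move=> p1 /andP[l0 l1] a0 b0; have p0 : 0 < p by rewrite (lt_le_trans _ p1).
have [->|pn1] := eqVneq p 1.
  by rewrite invr1 subrr !powRr0 !powRr1 ?addr_ge0// !mul1r.
have {}p1 : 1 < p by rewrite lt_neqAle eq_sym pn1.
have r0 : 0 < 1 - p^-1 by rewrite subr_gt0 invf_lt1.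
have := @hoelder2 R a b ((1 - l) `^ (1 - p^-1)) (l `^ (1 - p^-1))
  p (1 - p^-1)^-1 a0 b0 (powR_ge0 _ _) (powR_ge0 _ _) p0.
rewrite invr_gt0 invrK subrKC => /(_ r0 erefl).
rewrite -!powRrM divff ?gt_eqF// !powRr1 ?subr_ge0// subrK powR1 mulr1.
by rewrite ![a * _]mulrC ![b * _]mulrC.
Qed.

(** Equality in Hoelder's inequality: [l] is the share of [b ^ p] in the sum. *)
Lemma lp_norm_attained p a b : 1 <= p -> 0 <= a -> 0 <= b ->
  exists2 l, 0 <= l <= 1 &
  (1 - l) `^ (1 - p^-1) * a + l `^ (1 - p^-1) * b = (a `^ p + b `^ p) `^ p^-1.
Proof.
move=> p1 a0 b0; have p0 : 0 < p by rewrite (lt_le_trans _ p1).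
set r := 1 - p^-1.
have ap := powR_ge0 a p; have bp := powR_ge0 b p.
have [S0|Sn0] := eqVneq (a `^ p + b `^ p) 0.
  have : a `^ p = 0 by lra. move/powR_eq0_eq0 => a0'.
  have : b `^ p = 0 by lra. move/powR_eq0_eq0 => b0'.
  exists 0; first by rewrite lexx ler01.
  by rewrite S0 a0' b0' !mulr0 addr0 powR0// invr_eq0 gt_eqF.
have S0 : 0 < a `^ p + b `^ p by rewrite lt_neqAle eq_sym Sn0 addr_ge0.
set S := a `^ p + b `^ p in S0 Sn0 *.
exists (b `^ p / S).
  by rewrite divr_ge0 ?(ltW S0)//= ler_pdivrMr// mul1r /S lerDr.
have -> : 1 - b `^ p / S = a `^ p / S by rewrite /S; field.
have termE c : 0 <= c -> (c `^ p / S) `^ r * c = c `^ p * S `^ (- r).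
  move=> c0; rewrite powRM ?powR_ge0 ?invr_ge0 ?(ltW S0)//.
  rewrite -powRrM -(@powR_inv1 _ S (ltW S0)) -powRrM mulN1r.
  have -> : p * r = p - 1 by rewrite /r mulrBr mulr1 divff// gt_eqF.
  by rewrite mulrAC mulrC [X in _ * X]mulrC mulr_powRB1// mulrC.
have -> : p^-1 = 1 + - r by rewrite /r; ring.
have -> : S `^ (1 + - r) = S * S `^ (- r).
  by rewrite powRD ?Sn0 ?implybT// powRr1// ltW.
by rewrite mulrDl; congr (_ + _); exact: termE.
Qed.

End powR_inequalities.

Section lp_bodies.
Variables (R : realType) (n : nat).
Implicit Types (Z : set 'rV[R]_n) (s t r : R).

(** The body [s Z - t Z]. *)
Definition diff_body s t Z : set 'rV[R]_n :=
  [set z | exists2 x, Z x & exists2 y, Z y & z = s *: x - t *: y].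

(** The union of the bodies [s Z - t Z] over [s ^ q + t ^ q = 1], where
    [r = 1 / q]; the parametrization by [l] makes sense for [r = 0] too. *)
Definition lp_body r Z : set 'rV[R]_n :=
  [set z | exists2 l, 0 <= l <= 1 & diff_body ((1 - l) `^ r) (l `^ r) Z z].

(** As [Z] contains the origin, [s Z] grows with [s]. *)
Lemma star_scale Z (x : 'rV[R]_n) s s' : is_convex Z -> Z 0 ->
  0 <= s <= s' -> Z x -> exists2 x', Z x' & s *: x = s' *: x'.
Proof.
move=> cZ Z0 /andP[s0 ss'] Zx.
have [s'0|s'n0] := eqVneq s' 0.
  by exists x => //; rewrite s'0; congr (_ *: _); lra.
have s'0 : 0 < s' by rewrite lt_neqAle eq_sym s'n0 (le_trans s0).
exists ((s / s') *: x); last by rewrite scalerA mulrC divfK.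
have := cZ 0 x (s / s') _ Z0 Zx; rewrite scaler0 add0r; apply.
by rewrite divr_ge0 ?(ltW s'0)//= ler_pdivrMr// mul1r.
Qed.

Lemma diff_body_mono Z s t s' t' : is_convex Z -> Z 0 ->
  0 <= s <= s' -> 0 <= t <= t' -> diff_body s t Z `<=` diff_body s' t' Z.
Proof.
move=> cZ Z0 ss tt _ [x Zx [y Zy ->]].
have [x' Zx' ->] := star_scale cZ Z0 ss Zx.
have [y' Zy' ->] := star_scale cZ Z0 tt Zy.
by exists x' => //; exists y'.
Qed.

Lemma lp_body_compact r Z : 0 <= r -> compact Z -> compact (lp_body r Z).
Proof.
move=> r0 cZ.
pose f (l : R) : R := if r == 0 then 1 else powR_plus r l.
have fE l : 0 <= l -> f l = l `^ r.
  move=> l0; rewrite /f; case: ifPn => [/eqP ->|rn0]; first by rewrite powRr0.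
  by rewrite powR_plusE.
have cf : continuous f.
  rewrite /f; have [_|rn0] := eqVneq r 0; first exact: cst_continuous.
  by apply: powR_plus_continuous; rewrite lt_neqAle eq_sym rn0.
pose g (u : R * ('rV[R]_n * 'rV[R]_n)) : 'rV[R]_n :=
  f (1 - u.1) *: u.2.1 - f u.1 *: u.2.2.
have -> : lp_body r Z = g @` (`[0, 1] `*` (Z `*` Z)).
  apply/seteqP; split => z.
    move=> [l /andP[l0 l1] [x Zx [y Zy ->]]].
    exists (l, (x, y)); first by split => //=; rewrite in_itv/= l0.
    by rewrite /g/= !fE ?subr_ge0.
  move=> [[l [x y]] [/=]]; rewrite in_itv/= => /andP[l0 l1] [Zx Zy] <-.
  exists l; first by rewrite l0.
  by exists x => //; exists y => //; rewrite /g/= !fE ?subr_ge0.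
apply: continuous_compact.
  pose T := (R * ('rV[R]_n * 'rV[R]_n))%type.
  have c1 : continuous (fun u : T => u.1) by move=> u; exact: cvg_fst.
  have c2 : continuous (fun u : T => u.2) by move=> u; exact: cvg_snd.
  have c21 : continuous (fun u : T => u.2.1).
    by move=> u; apply: (cvg_comp _ _ (c2 u)); exact: cvg_fst.
  have c22 : continuous (fun u : T => u.2.2).
    by move=> u; apply: (cvg_comp _ _ (c2 u)); exact: cvg_snd.
  have cf1 : continuous (fun u : T => f u.1).
    by move=> u; apply: (cvg_comp _ _ (c1 u)); exact: cf.
  have c11 : continuous (fun u : T => 1 - u.1).
    by move=> u; apply: continuousB; [exact: cst_continuous|exact: c1].
  have cf11 : continuous (fun u : T => f (1 - u.1)).
    by move=> u; apply: (cvg_comp _ _ (c11 u)); exact: cf.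
  apply: continuous_subspaceT => u.
  apply: (@continuousB _ _ _ (fun u : T => f (1 - u.1) *: u.2.1)
    (fun u : T => f u.1 *: u.2.2)).
    by apply: cvgZ; [exact: cf11|exact: c21].
  by apply: cvgZ; [exact: cf1|exact: c22].
apply: compact_setX; first exact: segment_compact.
exact: compact_setX.
Qed.

(** A convex combination of a point of [s Z - t Z] and one of [s' Z - t' Z] lies
    in the body for the corresponding combinations of [s, s'] and [t, t'];
    by concavity of [x ^ r], that body is contained in one of the union. *)
Lemma lp_body_convex r Z : 0 <= r <= 1 -> is_convex Z -> Z 0 ->
  is_convex (lp_body r Z).
Proof.
move=> /andP[r0 r1] cZ Z0 _ _ t /[dup] t01 /andP[t0 t1]
  [l /andP[l0 l1] [x Zx [y Zy ->]]] [m /andP[m0 m1] [x' Zx' [y' Zy' ->]]].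
have conv2 (a b : R) (z z' : 'rV[R]_n) : 0 <= a -> 0 <= b -> Z z -> Z z' ->
    exists2 z'', Z z'' & a *: z + b *: z' = (a + b) *: z''.
  move=> a0 b0 Zz Zz'; have [ab0|abn0] := eqVneq (a + b) 0.
    exists z => //; have -> : a = 0 by lra. have -> : b = 0 by lra.
    by rewrite addr0 !scale0r addr0.
  have ab0 : 0 < a + b by rewrite lt_neqAle eq_sym abn0 addr_ge0.
  exists ((1 - b / (a + b)) *: z + (b / (a + b)) *: z').
    apply: cZ => //; rewrite divr_ge0 ?(ltW ab0)//=.
    by rewrite ler_pdivrMr// mul1r lerDr.
  rewrite scalerDr !scalerA; congr (_ *: _ + _ *: _); by field.
have conc (a b : R) : 0 <= a -> 0 <= b ->
    (1 - t) * a `^ r + t * b `^ r <= ((1 - t) * a + t * b) `^ r.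
  have [->|rn0] := eqVneq r 0; first by move=> _ _; rewrite !powRr0; lra.
  by apply: concave_powR => //; rewrite lt_neqAle eq_sym rn0 r0.
have l1' : 0 <= 1 - l by lra. have m1' : 0 <= 1 - m by lra.
have t1' : 0 <= 1 - t by lra.
have ge (c a : R) : 0 <= c -> 0 <= c * a `^ r.
  by move=> ?; rewrite mulr_ge0 ?powR_ge0.
have [x1 Zx1 xE] := conv2 _ _ x x' (ge _ (1 - l) t1') (ge _ (1 - m) t0) Zx Zx'.
have [y1 Zy1 yE] := conv2 _ _ y y' (ge _ l t1') (ge _ m t0) Zy Zy'.
exists ((1 - t) * l + t * m).
  by apply/andP; split; nra.
apply: (@diff_body_mono Z ((1 - t) * (1 - l) `^ r + t * (1 - m) `^ r)
    ((1 - t) * l `^ r + t * m `^ r)) => //.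
- rewrite addr_ge0 ?ge//=.
  have -> : 1 - ((1 - t) * l + t * m) = (1 - t) * (1 - l) + t * (1 - m) by ring.
  exact: conc.
- by rewrite addr_ge0 ?ge//=; exact: conc.
exists x1 => //; exists y1 => //.
rewrite -xE -yE -!scalerA !scalerBr; apply/rowP => i; rewrite !mxE; ring.
Qed.

Lemma lp_body_support p Z (x : 'rV[R]_n) : 1 <= p -> compact Z -> Z 0 ->
  support_fun (lp_body (1 - p^-1) Z) x =
  (support_fun Z x `^ p + support_fun (-%R @` Z) x `^ p) `^ p^-1.
Proof.
move=> p1 cZ Z0.
have Zn0 : Z !=set0 by exists 0.
have cNZ : compact (-%R @` Z).
  apply: continuous_compact => //; apply: continuous_subspaceT => u.
  exact: continuousN.
have hN y : Z y -> - dotv x y <= support_fun (-%R @` Z) x.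
  by move=> Zy; rewrite -dotvNr; apply: le_support_fun => //; exists y.
have h0 (K : set 'rV[R]_n) : compact K -> K 0 -> 0 <= support_fun K x.
  move=> cK K0; rewrite -(_ : dotv x 0 = 0); first exact: le_support_fun.
  by rewrite -(scale0r 0) dotvZr mul0r.
have hZ0 := h0 _ cZ Z0.
have hNZ0 : 0 <= support_fun (-%R @` Z) x.
  by apply: h0 => //; exists 0; rewrite ?oppr0.
apply: support_funE.
  move=> _ [l l01 [z Zz [y Zy ->]]].
  apply: le_trans (lp_norm_ge p1 l01 hZ0 hNZ0).
  rewrite dotvBr !dotvZr -mulrN lerD// ler_wpM2l ?powR_ge0 ?hN//.
  exact: le_support_fun.
have [l l01 <-] := lp_norm_attained p1 hZ0 hNZ0.
have [z Zz [-> _]] := support_fun_max x Zn0 cZ.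
have [|_ [y Zy <-] [-> _]] := @support_fun_max _ _ (-%R @` Z) x _ cNZ.
  by exists (- 0), 0.
exists ((1 - l) `^ (1 - p^-1) *: z - l `^ (1 - p^-1) *: y).
  by exists l => //; exists z => //; exists y.
by rewrite dotvBr !dotvZr dotvNr mulrN.
Qed.

(** The union is one of the sets that [Lp_sum] chooses from, and by
    [support_fun_inj] it is the only one. *)
Lemma Lp_sumE p Z : 1 <= p -> compact Z -> is_convex Z -> Z 0 ->
  Lp_sum p Z (-%R @` Z) = lp_body (1 - p^-1) Z.
Proof.
move=> p1 cZ coZ Z0.
have p0 : 0 < p by rewrite (lt_le_trans _ p1).
have r01 : 0 <= 1 - p^-1 <= 1.
  by rewrite subr_ge0 invf_le1// p1 gerBl invr_ge0 ltW.
have D0 : lp_body (1 - p^-1) Z !=set0.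
  exists 0, 0; first by rewrite lexx ler01.
  by exists 0 => //; exists 0 => //; rewrite !scaler0 subr0.
have cD : compact (lp_body (1 - p^-1) Z).
  by apply: lp_body_compact => //; case/andP: r01.
have coD := lp_body_convex r01 coZ Z0.
rewrite /Lp_sum; case: xgetP => [M ME|]; last first.
  move=> /(_ (lp_body (1 - p^-1) Z)) []; split => //; first exact/convex_setP.
  by move=> x; exact: lp_body_support.
move=> [M0 cM /convex_setP coM hM]; apply/seteqP.
have hMD x : support_fun M x = support_fun (lp_body (1 - p^-1) Z) x.
  by rewrite hM lp_body_support.
by split; apply: support_fun_inj.
Qed.

End lp_bodies.

(** * Zonoids are convex and centrally symmetric *)

Section zonoids.
Variables (R : realType) (n : nat).
Implicit Types (P Z : set 'rV[R]_n).

Definition centrally_symmetric_about Z (w : 'rV[R]_n) :=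
  forall x, Z x -> Z (w - x).

Lemma closed_approx Z x : closed Z ->
  (forall e : R, 0 < e -> exists2 z, Z z & `|x - z| < e) -> Z x.
Proof.
move=> clZ xZ; apply: clZ => B /nbhs_ballP[e /= e0 xeB].
have [z Zz xz] := xZ e e0; exists z; split => //.
by apply: xeB; rewrite -ball_normE.
Qed.

Lemma zonotope_convex P : asymmetric_L1_zonotope P -> is_convex P.
Proof.
move=> [m [a [b [_ ->]]]] _ _ t t01 [x Sx <-] [y Sy <-].
exists (fun i => (1 - t) *: x i + t *: y i); last first.
  by rewrite !scaler_sumr -big_split.
move=> i; have [l l01 <-] := Sx i; have [k k01 <-] := Sy i.
exists ((1 - t) * l + t * k).
  move: t01 l01 k01; rewrite /= !in_itv/= => /andP[? ?] /andP[? ?] /andP[? ?].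
  by apply/andP; split; nra.
by apply/rowP => j; rewrite !mxE; ring.
Qed.

(** Each segment [[a, b]] is symmetric about [(a + b) / 2], so [w] is the sum of
    all [a + b]; it belongs to [P] because [P] contains [0]. *)
Lemma zonotope_symmetric P : asymmetric_L1_zonotope P ->
  exists2 w, P w & centrally_symmetric_about P w.
Proof.
move=> [m [a [b [S0 ->]]]].
pose w := \sum_(i < m) (a i + b i).
have segS i x : segment (a i) (b i) x -> segment (a i) (b i) (a i + b i - x).
  move=> [t]; rewrite /= in_itv/= => /andP[t0 t1] <-; exists (1 - t).
    by rewrite /= in_itv/=; apply/andP; split; lra.
  by apply/rowP => j; rewrite !mxE; ring.
exists w.
  exists (fun i => a i + b i) => // i.
  by have := segS i 0 (S0 i); rewrite subr0.
move=> _ [x Sx <-]; exists (fun i => a i + b i - x i).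
  by move=> i; exact: segS.
by rewrite sumrB.
Qed.

Lemma hausdorff_near (P : nat -> set 'rV[R]_n) Z (e : R) :
  hausdorff_cvg P Z -> 0 < e -> exists N, forall k, (N <= k)%N ->
    (forall x, P k x -> exists2 z, Z z & `|x - z| < e) /\
    (forall z, Z z -> exists2 x, P k x & `|z - x| < e).
Proof.
move=> PZ e0; have [N _ PNZ] := PZ e e0; exists N => k /PNZ[PkZ ZPk].
split => [x /PkZ[z Zz]|z /ZPk[x Px]]; rewrite -ball_normE /= distrC.
  by exists z.
by exists x.
Qed.

Lemma zonoid_convex Z : asymmetric_L1_zonoid Z -> is_convex Z.
Proof.
move=> [cZ [P [zP PZ]]] x y t /[dup] t01 /andP[t0 t1] Zx Zy.
apply: closed_approx; first exact: compact_closed.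
move=> e e0; have e20 : 0 < e / 2 by rewrite divr_gt0.
have [N /(_ N (leqnn N))[PkZ ZPk]] := hausdorff_near PZ e20.
have [x' Px' xx'] := ZPk x Zx; have [y' Py' yy'] := ZPk y Zy.
have [z Zz zz'] := PkZ _ (zonotope_convex (zP N) t01 Px' Py').
exists z => //.
have -> : (1 - t) *: x + t *: y - z =
    (1 - t) *: (x - x') + t *: (y - y') + ((1 - t) *: x' + t *: y' - z).
  by apply/rowP => j; rewrite !mxE; ring.
apply: le_lt_trans (ler_normD _ _) _.
have := ler_normD ((1 - t) *: (x - x')) (t *: (y - y')).
rewrite !normrZ !ger0_norm ?subr_ge0//; nra.
Qed.

(** The vectors [w] of the approximating zonotopes lie in these zonotopes, hence
    in a bounded set, and any cluster point of theirs serves for the limit. *)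
Lemma zonoid_symmetric Z : asymmetric_L1_zonoid Z ->
  exists w, centrally_symmetric_about Z w.
Proof.
move=> [cZ [P [zP PZ]]].
have zw k : exists w, P k w /\ centrally_symmetric_about (P k) w.
  by have [w ? ?] := zonotope_symmetric (zP k); exists w.
have [w /all_and2[Pw wS]] := choice zw.
have [M [_ ZM]] := compact_bounded cZ.
have [N1 N1P] := hausdorff_near PZ (@ltr01 R).
pose B : set 'rV[R]_n := [set x | `|x| <= M + 2].
have cB : compact B.
  apply: bounded_closed_compact.
    exists (M + 2); split; first exact: num_real.
    by move=> r Mr x xM; apply: le_trans (ltW Mr).
  apply: (@closed_comp _ _ (fun x : 'rV[R]_n => `|x|) [set r | r <= M + 2]).
    by move=> x _; exact: norm_continuous.
  exact: closed_le.
have [|v [_ clv]] := cB (w @ \oo) _ _.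
  exists N1 => // k /= /N1P[PkZ _]; have [z Zz wz] := PkZ _ (Pw k).
  have zM : `|z| <= M + 1 by apply: ZM => //; rewrite ltrDl.
  rewrite /B /= -(subrK z (w k)).
  by apply: le_trans (ler_normD _ _) _; lra.
exists v => z Zz; apply: closed_approx; first exact: compact_closed.
move=> e e0; have e30 : 0 < e / 3 by rewrite divr_gt0.
have [N NP] := hausdorff_near PZ e30.
have [||_ [[k Nk <-] vk]] :=
    clv [set w k | k in [set k | (N <= k)%N]] (ball v (e / 3)).
- by exists N => // k Nk; exists k.
- exact: nbhsx_ballx.
have {NP} [PkZ ZPk] := NP k Nk.
have [x Px zx] := ZPk z Zz; have [y Zy yx] := PkZ _ (wS k x Px).
exists y => //; move: vk; rewrite -ball_normE /= => vk.
have -> : v - z - y = (v - w k) - (z - x) + (w k - x - y).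
  by apply/rowP => j; rewrite !mxE; ring.
apply: le_lt_trans (ler_normD _ _) _.
have := ler_normB (v - w k) (z - x); lra.
Qed.

End zonoids.

(** * Volumes of scaled difference bodies and of chains of sets *)

Section measure_chains.
Local Open Scope ereal_scope.
Context d (T : measurableType d) (R : realType).
Variable mu : {measure set T -> \bar R}.
Variables (W J : nat -> set T).
Hypotheses (mW : forall k, measurable (W k)) (mJ : forall k, measurable (J k)).
Hypothesis Wfin : forall k, mu (W k) < +oo.

Let measure_setU (A B : set T) : measurable A -> measurable B -> mu B < +oo ->
  mu (A `|` B) = mu A + (mu B - mu (B `&` A)).
Proof.
by move=> mA mB Bfin; rewrite measureUfinr// setIC addeA.
Qed.

Let mbigW m : measurable (\big[setU/set0]_(k < m) W k).
Proof. exact: bigsetU_measurable. Qed.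

(** Each new set [W k.+1] adds at most its part outside [J k], as [J k] is
    contained in the previous set. *)
Lemma measure_chain_le m :
  (forall k, (k < m)%N -> J k `<=` W k `&` W k.+1) ->
  mu (\big[setU/set0]_(k < m.+1) W k) <=
  mu (W 0%N) + \sum_(k < m) (mu (W k.+1) - mu (J k)).
Proof.
elim: m => [|m IH] JW.
  by rewrite big_ord1 big_ord0 adde0.
rewrite big_ord_recr/= measure_setU//; last exact: mbigW.
rewrite [in leRHS]big_ord_recr/= [leRHS]addeA leeD//.
  by apply: IH => k km; apply: JW; exact: ltnW.
apply: leeB => //; apply: le_measure; rewrite ?inE//.
  by apply: measurableI => //; exact: mbigW.
apply: subset_trans (JW m (ltnSn m)) _ => x [Wx Wx']; split => //.
by rewrite big_ord_recr/=; right.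
Qed.

(** Here [J k] covers all that [W k.+1] has in common with the earlier sets. *)
Lemma measure_chain_ge m :
  (forall j k, (j <= k < m)%N -> W k.+1 `&` W j `<=` J k) ->
  mu (W 0%N) + \sum_(k < m) (mu (W k.+1) - mu (J k)) <=
  mu (\big[setU/set0]_(k < m.+1) W k).
Proof.
elim: m => [|m IH] JW.
  by rewrite big_ord1 big_ord0 adde0.
rewrite [in leRHS]big_ord_recr/= measure_setU//; last exact: mbigW.
rewrite big_ord_recr/= [leLHS]addeA leeD//.
  apply: IH => j k /andP[jk km]; apply: JW.
  by rewrite jk/= ltnS ltnW.
apply: leeB => //; apply: le_measure; rewrite ?inE//.
  by apply: measurableI => //; exact: mbigW.
move=> x [Wx]; rewrite -bigcup_mkord => -[j /= jm Wj].
by apply: (JW j m); rewrite ?ltnSn ?andbT// -ltnS.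
Qed.

End measure_chains.

Section diff_body_volume.
Variables (R : realType) (n : nat) (Z : set 'rV[R]_n) (w : 'rV[R]_n).
Hypotheses (cZ : compact Z) (coZ : is_convex Z).
Hypothesis symZ : centrally_symmetric_about Z w.

(** Since [- Z = Z - w], the body [s Z - t Z] is [(s + t) Z - t w]. *)
Let diff_bodyE (s t : R) : 0 <= s -> 0 <= t -> 0 < s + t ->
  diff_body s t Z =
  [set x | Z ((s + t)^-1 *: x + ((s + t)^-1 * t) *: w)].
Proof.
move=> s0 t0 st0; have stn0 : s + t != 0 by rewrite gt_eqF.
apply/seteqP; split => z /=.
  move=> [x Zx [y Zy ->]].
  have -> : (s + t)^-1 *: (s *: x - t *: y) + ((s + t)^-1 * t) *: w =
      (1 - t / (s + t)) *: x + (t / (s + t)) *: (w - y).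
    by apply/rowP => i; rewrite !mxE; field.
  apply: coZ => //; last exact: symZ.
  by rewrite divr_ge0 ?(ltW st0)//= ler_pdivrMr// mul1r lerDr.
set v := (X in Z X) => Zv; exists v => //; exists (w - v); first exact: symZ.
by apply/rowP => i; rewrite /v !mxE; field.
Qed.

Lemma measurable_diff_body (s t : R) : 0 <= s -> 0 <= t -> 0 < s + t ->
  measurable (diff_body s t Z : set (rV_measurableType R n)).
Proof.
move=> s0 t0 st0; rewrite diff_bodyE//; apply: closed_measurable_rV.
apply: (@closed_comp _ _
  (fun x : 'rV[R]_n => (s + t)^-1 *: x + ((s + t)^-1 * t) *: w) Z).
  move=> x _; apply: continuousD; last exact: cst_continuous.
  exact: scaler_continuous.
exact: compact_closed.
Qed.

Lemma lebesgue_diff_body (s t : R) : 0 <= s -> 0 <= t -> 0 < s + t ->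
  lebesgue_rV (diff_body s t Z) = (((s + t) ^+ n)%:E * lebesgue_rV Z)%E.
Proof.
move=> s0 t0 st0; rewrite diff_bodyE// lebesgue_rV_affine ?invr_gt0//.
  by rewrite invrK.
exact: compact_measurable_rV.
Qed.

End diff_body_volume.

Section parallelotopes.
Variables (R : realType) (n : nat).

(** The origin is [x + t0 V] with [t0] in the unit cube.  If some coordinate of
    [t0] were strictly between [0] and [1], the origin would be the midpoint of
    a segment of [Z] in the corresponding edge direction, and so not a vertex.
    Hence all coordinates are [0] or [1], and changing the signs of the
    coordinates with value [1] maps [Z] to the unit cube. *)
Lemma parallelotope_at_vertex (Z : set 'rV[R]_n) :
  parallelotope Z -> vertex Z 0 -> exists2 A : 'M[R]_n, A \in unitmx &
  forall z, Z z <-> forall i, 0 <= (z *m A) 0 i <= 1.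
Proof.
move=> [x [V [uV ZE]]] [Z0 ext0].
have [t0 t01 xE] : exists2 t : 'rV[R]_n,
    (forall i, 0 <= t 0 i <= 1) & 0 = x + t *m V.
  by move: Z0; rewrite ZE => -[t t01 <-]; exists t.
have ZP z : Z z <-> forall i, 0 <= t0 0 i + (z *m invmx V) 0 i <= 1.
  rewrite ZE; split => [[t tt <-] i|zt].
    have -> : (x + t *m V) *m invmx V = t - t0.
      have -> : x = - (t0 *m V) by apply/eqP; rewrite -addr_eq0 -xE.
      by rewrite mulmxDl mulNmx !mulmxK// addrC.
    by rewrite !mxE subrKC; exact: tt.
  exists (t0 + z *m invmx V).
    by move=> i; have := zt i; rewrite !mxE.
  by rewrite mulmxDl addrA -xE add0r mulmxKV.
have t0E i : t0 0 i = 0 \/ t0 0 i = 1.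
  have /andP[ge0 le1] := t01 i.
  apply: contrapT => /not_orP[/eqP n0 /eqP n1].
  have gt0 : 0 < t0 0 i by rewrite lt_neqAle eq_sym n0.
  have lt1 : t0 0 i < 1 by rewrite lt_neqAle n1.
  pose d := Num.min (t0 0 i) (1 - t0 0 i).
  have d0 : 0 < d by rewrite lt_min gt0 subr_gt0.
  have dle : d <= t0 0 i /\ d <= 1 - t0 0 i.
    by split; rewrite /d ge_min lexx ?orbT.
  pose e : 'rV[R]_n := d *: delta_mx 0 i.
  have eZ (c : R) : `|c| <= 1 -> Z (c *: e *m V).
    rewrite ler_norml => /andP[c1 c2]; apply/ZP => j.
    rewrite mulmxK// !mxE/=; have [->|ji] := eqVneq j i.
      by rewrite mulr1; apply/andP; split; nra.
    by rewrite !mulr0 addr0.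
  have h : (0 : 'rV[R]_n) =
      (1 - 2^-1) *: ((- 1) *: e *m V) + 2^-1 *: (1 *: e *m V).
    rewrite -!scalemxAl !scalerA -scalerDl (_ : _ + _ = 0) ?scale0r//.
    by field.
  have N1 : `|-1 : R| <= 1 by rewrite normrN1.
  have P1 : `|1 : R| <= 1 by rewrite normr1.
  have half : 0 < (2^-1 : R) < 1 by apply/andP; split; lra.
  have [_ /eqP] := ext0 _ _ 2^-1 (eZ _ N1) (eZ _ P1) half h.
  rewrite scale1r => /eqP eV0.
  have /rowP/(_ i) : e = 0 by rewrite -(mulmxK uV e) eV0 mul0mx.
  rewrite !mxE !eqxx mulr1 => d0'; by rewrite d0' ltxx in d0.
pose sg : 'rV[R]_n := \row_i (1 - 2 * t0 0 i).
have sg2 : diag_mx sg *m diag_mx sg = 1%:M.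
  rewrite mulmx_diag -diag_const_mx; congr diag_mx; apply/rowP => i.
  by rewrite !mxE; case: (t0E i) => ->; ring.
exists (invmx V *m diag_mx sg).
  by rewrite unitmx_mul unitmx_inv uV/=; have [] := mulmx1_unit sg2.
have sgE (z : 'rV[R]_n) i :
    (z *m (invmx V *m diag_mx sg)) 0 i = (z *m invmx V) 0 i * (1 - 2 * t0 0 i).
  by rewrite mulmxA mul_mx_diag mxE; congr (_ * _); rewrite mxE.
move=> z; rewrite ZP; split => h i; have := h i; rewrite sgE;
  by case: (t0E i) => -> /andP[? ?]; apply/andP; split; lra.
Qed.

(** In the coordinates where [Z] is the unit cube, [s Z - t Z] is the cube
    [[- t, s] ^ n]. *)
Lemma diff_body_parallelotope (Z : set 'rV[R]_n) (A : 'M[R]_n) (s t : R) :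
  A \in unitmx -> (forall z, Z z <-> forall i, 0 <= (z *m A) 0 i <= 1) ->
  0 <= s -> 0 <= t ->
  diff_body s t Z = [set z | forall i, - t <= (z *m A) 0 i <= s].
Proof.
move=> uA ZP s0 t0; apply/seteqP; split => z /=.
  move=> [x /ZP Zx [y /ZP Zy ->]] i.
  rewrite mulmxBl -!scalemxAl mxE [X in X + _]mxE [X in _ + X]mxE.
  rewrite [X in _ - X]mxE.
  by have /andP[? ?] := Zx i; have /andP[? ?] := Zy i; apply/andP; split; nra.
move=> zst.
(* The positive and the negative parts of the coordinates of [z].  When [s = 0]
   or [t = 0], the part divided by it vanishes. *)
pose x : 'rV[R]_n := \row_i (Num.max 0 ((z *m A) 0 i) / s).
pose y : 'rV[R]_n := \row_i (Num.max 0 (- (z *m A) 0 i) / t).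
have in01 (c a : R) : 0 <= c -> a <= c -> 0 <= Num.max 0 a / c <= 1.
  rewrite le_eqVlt => /orP[/eqP <- a0|c0 ac].
    by rewrite invr0 mulr0 lexx ler01.
  rewrite divr_ge0 ?le_max ?lexx ?(ltW c0)//= ler_pdivrMr// mul1r.
  by rewrite ge_max (ltW c0).
have cancelE (c a : R) :
    0 <= c -> a <= c -> c * (Num.max 0 a / c) = Num.max 0 a.
  rewrite le_eqVlt => /orP[/eqP <- a0|c0 ac].
    by rewrite mul0r max_l.
  by rewrite mulrC divfK// gt_eqF.
exists (x *m invmx A).
  apply/ZP => i; rewrite mulmxKV// mxE; apply: in01 => //.
  by have /andP[] := zst i.
exists (y *m invmx A).
  apply/ZP => i; rewrite mulmxKV// mxE; apply: in01 => //.
  by rewrite lerNl; have /andP[] := zst i.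
rewrite !scalemxAl -mulmxBl -[LHS](mulmxK uA); congr (_ *m _).
apply/rowP => i; have /andP[zt zs] := zst i.
rewrite [RHS]mxE [X in _ = X + _]mxE [X in _ = _ + X]mxE [X in _ = _ - X]mxE.
rewrite [x 0 i]mxE [y 0 i]mxE !cancelE// 1?lerNl//.
have [a0|a0] := leP 0 ((z *m A) 0 i).
  by rewrite max_l ?oppr_le0// subr0.
by rewrite max_r ?oppr_ge0 ?ltW// sub0r opprK.
Qed.

(** In the coordinates where [Z] is the unit cube, the two bodies are the cubes
    [[- b, a] ^ n] and [[- d, c] ^ n]. *)
Lemma diff_body_inter (Z : set 'rV[R]_n) (a b c d e : R) :
  parallelotope Z -> vertex Z 0 ->
  0 <= a -> 0 <= b -> 0 <= c -> 0 <= d -> c <= e ->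
  diff_body a b Z `&` diff_body c d Z `<=` diff_body e b Z.
Proof.
move=> pZ vZ a0 b0 c0 d0 ce; have e0 := le_trans c0 ce.
have [A uA ZA] := parallelotope_at_vertex pZ vZ.
rewrite !(diff_body_parallelotope uA ZA)// => z [zab zcd] i.
have /andP[bz _] := zab i; have /andP[_ zc] := zcd i.
by rewrite bz (le_trans zc ce).
Qed.

End parallelotopes.

(** * The volume of the Lp sum *)

(** The Archimedean property; starting at [N = 2] suits [lp_body_volume_ge]. *)
Lemma ler_add_inv (R : realType) (x y C : R) :
  (forall N, (1 < N)%N -> x <= y + C / N%:R) -> x <= y.
Proof.
move=> h; apply/ler_addgt0Pr => e e0.
have [C0|C0] := leP C 0.
  apply: (le_trans (h 2%N isT)); rewrite lerD2l (le_trans _ (ltW e0))//.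
  by rewrite mulr_le0_ge0.
have := h (Num.truncn (C / e)).+2 isT; move/le_trans; apply.
rewrite lerD2l ler_pdivrMr// mulrC -ler_pdivrMr//.
apply: (le_trans (ltW (truncnS_gt _))).
by rewrite ler_nat.
Qed.

Lemma curve_s_bracket (R : realType) N (x : R) : (0 < N)%N -> 0 <= x <= 1 ->
  exists2 k, (k < N)%N & curve_s R N k <= x <= curve_s R N k.+1.
Proof.
move=> N0 /andP[x0 x1].
have exk : exists k, x <= curve_s R N k by exists N; rewrite curve_sN.
have [[|k] xk kmin] := ex_minnP exk.
  exists 0%N => //; rewrite curve_s0 x0; apply: (le_trans xk).
  exact: curve_s_le.
have kN : (k < N)%N by apply: kmin; rewrite curve_sN.
exists k => //; rewrite xk andbT leNgt; apply/negP => /ltW /kmin.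
by rewrite ltnn.
Qed.

Section lp_body_volume.
Variables (R : realType) (n : nat) (Z : set 'rV[R]_n) (w : 'rV[R]_n).
Hypotheses (cZ : compact Z) (coZ : is_convex Z) (Z0 : Z 0).
Hypothesis symZ : centrally_symmetric_about Z w.
Variables (r : R) (r0 : 0 < r).

Local Notation mu := (@lebesgue_rV R n).
Local Notation s N := (curve_s R N).
Local Notation t N := (curve_t r N).

Let m := fine (mu Z).

Let muZ : mu Z = m%:E.
Proof. by rewrite fineK// compact_lebesgue_rV_fin. Qed.

Let muD a b : 0 <= a -> 0 <= b -> 0 < a + b ->
  mu (diff_body a b Z) = ((a + b) ^+ n * m)%:E.
Proof.
by move=> a0 b0 ab0; rewrite (lebesgue_diff_body cZ coZ symZ)// muZ -EFinM.
Qed.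

Let mD a b : 0 <= a -> 0 <= b -> 0 < a + b ->
  measurable (diff_body a b Z : set (rV_measurableType R n)).
Proof. exact: (measurable_diff_body cZ coZ symZ). Qed.

Let sS_gt0 N k : (0 < N)%N -> 0 < s N k.+1.
Proof. by move=> N0; rewrite divr_gt0 ?ltr0n. Qed.

Let mlp : measurable (lp_body r Z : set (rV_measurableType R n)).
Proof.
by apply: compact_measurable_rV; apply: lp_body_compact => //; exact: ltW.
Qed.

(** For a point of the curve with [s_k <= s <= s_(k + 1)] one has [t <= t_k]. *)
Lemma lp_body_cover N : (0 < N)%N ->
  lp_body r Z `<=` \big[setU/set0]_(k < N) diff_body (s N k.+1) (t N k) Z.
Proof.
move=> N0 z [l /andP[l0 l1] zl].
rewrite -(bigcup_mkord N (fun k => diff_body (s N k.+1) (t N k) Z)).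
have l1' : 0 <= 1 - l by rewrite subr_ge0.
have s01 : 0 <= (1 - l) `^ r <= 1.
  rewrite powR_ge0/=; apply: (@le_trans _ _ (1 `^ r)); last by rewrite powR1.
  apply: ge0_ler_powR; rewrite ?nnegrE//.
    exact: ltW.
  by rewrite gerBl.
have [k kN /andP[sk sk1]] := curve_s_bracket N0 s01; exists k => //.
apply: diff_body_mono zl => //; first by rewrite powR_ge0.
rewrite powR_ge0/=; have sk0 := curve_s_ge0 R N k.
have h : s N k `^ r^-1 <= 1 - l.
  have -> : 1 - l = ((1 - l) `^ r) `^ r^-1.
    by rewrite -powRrM divff ?powRr1// gt_eqF.
  by apply: ge0_ler_powR; rewrite ?nnegrE ?powR_ge0 ?invr_ge0// ltW.
rewrite lerBrDr -lerBrDl in h.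
apply: ge0_ler_powR; rewrite ?nnegrE//; first exact: ltW.
exact: (le_trans l0).
Qed.

(** The covering bodies [s_(k + 1) Z - t_k Z] and
    [s_(k + 2) Z - t_(k + 1) Z] both contain [s_(k + 1) Z - t_(k + 1) Z]. *)
Lemma lp_body_volume_le N : (0 < N)%N ->
  (mu (lp_body r Z) <= (volume_sum N n (t N) * m)%:E)%E.
Proof.
case: N => // M _; set N := M.+1.
have N0 : (0 < N)%N by [].
pose W k := diff_body (s N k.+1) (t N k) Z.
pose J k := diff_body (s N k.+1) (t N k.+1) Z.
have sP k l : 0 < s N k.+1 + t N l by rewrite ltr_wpDr ?curve_t_ge0 ?sS_gt0.
have s0 k : 0 <= s N k by exact: curve_s_ge0.
have t0 k : 0 <= t N k by exact: curve_t_ge0.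
have mW k : measurable (W k : set (rV_measurableType R n)).
  exact: (mD (s0 k.+1) (t0 k) (sP k k)).
have mJ k : measurable (J k : set (rV_measurableType R n)).
  exact: (mD (s0 k.+1) (t0 k.+1) (sP k k.+1)).
apply: (@le_trans _ _ (mu (\big[setU/set0]_(k < N) W k))).
  apply: le_measure; rewrite ?inE//; first exact: bigsetU_measurable.
  exact: lp_body_cover.
have Wfin k : (mu (W k) < +oo)%E 
  by rewrite /W (muD (s0 k.+1) (t0 k) (sP k k)) ltry.
apply: (le_trans (measure_chain_le mW mJ Wfin (m := M) _)).
- move=> k kM x Jx; split; apply: diff_body_mono Jx => //.
  + by rewrite s0 lexx.
  + by rewrite t0/= curve_t_le// leqnSn/= ltnS ltnW.
  + by rewrite s0 curve_s_le.
  + by rewrite t0 lexx.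
rewrite (eq_bigr (fun k : 'I_M =>
  (((s N k.+2 + t N k.+1) ^+ n - (s N k.+1 + t N k.+1) ^+ n) * m)%:E));
  last first.
  move=> k _ /=; rewrite /W /J (muD (s0 k.+2) (t0 k.+1) (sP _ _)).
  by rewrite (muD (s0 k.+1) (t0 k.+1) (sP _ _)) -EFinB -mulrBl.
rewrite /= /W (muD (s0 1%N) (t0 0%N) (sP _ _)) sumEFin -EFinD lee_fin.
rewrite -mulr_suml -mulrDl.
rewrite /volume_sum big_ord_recl/= curve_s0 curve_t0// add0r expr1n.
by rewrite /bump/= addrA subrKC.
Qed.

(** The bodies [s_k Z - t_k Z] belong to the union, and by [diff_body_inter]
    the one of index [k + 1] meets all those before it within
    [s_k Z - t_(k + 1) Z]. *)
Lemma lp_body_volume_ge N : (1 < N)%N -> parallelotope Z -> vertex Z 0 ->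
  ((volume_sum N n (fun k => t N k.+1) * m)%:E <= mu (lp_body r Z))%E.
Proof.
move=> N1 pZ vZ; have N0 : (0 < N)%N by exact: ltnW.
pose W k := diff_body (s N k) (t N k) Z.
pose J k := diff_body (s N k) (t N k.+1) Z.
have s0 k : 0 <= s N k by exact: curve_s_ge0.
have t0 k : 0 <= t N k by exact: curve_t_ge0.
(* [1 < N] keeps [J 0], which is [- t_1 Z], from shrinking to a point. *)
have t1 : 0 < t N 1.
  rewrite powR_gt0// subr_gt0.
  apply: (@lt_le_trans _ _ (1 `^ r^-1)); last by rewrite powR1.
  apply: gt0_ltr_powR; rewrite ?nnegrE ?invr_gt0//.
  by rewrite /curve_s mul1r invf_lt1 ?ltr1n ?ltr0n.
have sP k l : 0 < s N k.+1 + t N l by rewrite ltr_wpDr ?curve_t_ge0 ?sS_gt0.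
have W0 k : 0 < s N k + t N k.
  by case: k => [|k]; [rewrite curve_s0 curve_t0// add0r|exact: sP].
have J0 k : 0 < s N k + t N k.+1.
  by case: k => [|k]; [rewrite curve_s0 add0r|exact: sP].
have mW k : measurable (W k : set (rV_measurableType R n)).
  exact: (mD (s0 k) (t0 k) (W0 k)).
have mJ k : measurable (J k : set (rV_measurableType R n)).
  exact: (mD (s0 k) (t0 k.+1) (J0 k)).
apply: (@le_trans _ _ (mu (\big[setU/set0]_(k < N.+1) W k))); last first.
  apply: le_measure; rewrite ?inE//; first exact: bigsetU_measurable.
  move=> z; rewrite -bigcup_mkord => -[k /=]; rewrite ltnS => kN Wz.
  have u1 : s N k `^ r^-1 <= 1.
    apply: (@le_trans _ _ (1 `^ r^-1)); last by rewrite powR1.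
    apply: ge0_ler_powR; rewrite ?nnegrE ?invr_ge0 ?(ltW r0)//.
    by rewrite -(curve_sN R N0) curve_s_le.
  have u0 := powR_ge0 (s N k) r^-1.
  exists (1 - s N k `^ r^-1); first by apply/andP; split; lra.
  rewrite opprB addrC subrK -powRrM mulVf ?gt_eqF// powRr1//.
have Wfin k : (mu (W k) < +oo)%E 
  by rewrite /W (muD (s0 k) (t0 k) (W0 k)) ltry.
apply: (le_trans _ (measure_chain_ge mW mJ Wfin (m := N) _)); last first.
- move=> j k /andP[jk kN].
  exact: (diff_body_inter pZ vZ (s0 k.+1) (t0 k.+1) (s0 j) (t0 j)
    (curve_s_le R N jk)).
rewrite (eq_bigr (fun k : 'I_N =>
  (((s N k.+1 + t N k.+1) ^+ n - (s N k + t N k.+1) ^+ n) * m)%:E)); last first.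
  move=> k _ /=; rewrite /W /J (muD (s0 k.+1) (t0 k.+1) (W0 _)).
  by rewrite (muD (s0 k) (t0 k.+1) (J0 k)) -EFinB -mulrBl.
rewrite /= /W (muD (s0 0%N) (t0 0%N) (W0 _)) sumEFin -EFinD lee_fin.
rewrite -mulr_suml -mulrDl.
by rewrite curve_s0 curve_t0// add0r expr1n.
Qed.

Let C : R := (\sum_(i < n) 'C(n, i.+1)%:R * i.+1%:R).

Lemma lp_body_volume_upper : (mu (lp_body r Z) <= (kappa r n)%:E * mu Z)%E.
Proof.
have cD : compact (lp_body r Z) by apply: lp_body_compact => //; exact: ltW.
have m0 : 0 <= m by rewrite fine_ge0.
rewrite muZ -EFinM -(fineK (compact_lebesgue_rV_fin cD)) lee_fin.
apply: (@ler_add_inv R _ _ (C * m)) => N N1; have N0 : (0 < N)%N by exact: ltnW.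
rewrite -lee_fin (fineK (compact_lebesgue_rV_fin cD)).
apply: (le_trans (lp_body_volume_le N0)); rewrite lee_fin.
rewrite mulrAC -mulrDl ler_wpM2r//.
apply: (le_trans (volume_sum_gap r0 N0 n)); rewrite lerD2r.
by have /andP[] := kappa_bounds r0 N0 n.
Qed.

Lemma lp_body_volume_parallelotope : parallelotope Z -> vertex Z 0 ->
  (mu (lp_body r Z) = (kappa r n)%:E * mu Z)%E.
Proof.
move=> pZ vZ; apply/eqP; rewrite eq_le lp_body_volume_upper/=.
have cD : compact (lp_body r Z) by apply: lp_body_compact => //; exact: ltW.
have m0 : 0 <= m by rewrite fine_ge0.
rewrite muZ -EFinM -(fineK (compact_lebesgue_rV_fin cD)) lee_fin.
apply: (@ler_add_inv R _ _ (C * m)) => N N1; have N0 : (0 < N)%N by exact: ltnW.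
rewrite -lerBlDr -lee_fin (fineK (compact_lebesgue_rV_fin cD)).
apply: le_trans (lp_body_volume_ge N1 pZ vZ); rewrite lee_fin.
rewrite [C * m / _]mulrAC -mulrBl ler_wpM2r// lerBlDr.
apply: le_trans (volume_sum_gap r0 N0 n).
by have /andP[] := kappa_bounds r0 N0 n.
Qed.

End lp_body_volume.

(** For [r = 0] all the real binomial coefficients are [1]. *)
Lemma kappa0 (R : realType) n : kappa (0 : R) n = 2 ^+ n.
Proof.
have G1 : Gamma (0 + 1 : R) = 1 by rewrite Gamma_gamma_mass gamma_mass0.
have b1 : binomR (0 : R) 0 = 1 by rewrite /binomR subrr G1 mulr1 divr1.
rewrite /kappa -[2]/(1 + 1) exprDn; apply: eq_bigr => i _.
by rewrite !mulr0 b1 divr1 !expr1n mulr1.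
Qed.

Lemma kappa_sE (R : realType) n (p : R) (q : \bar R) : p != 0 ->
  (p%:E^-1 + q^-1 = 1)%E -> kappa_s n q = kappa (1 - p^-1) n.
Proof.
move=> p0; rewrite inver (negPf p0) => pq.
have qE : (q^-1 = (1 - p^-1)%:E)%E.
  case: (q^-1)%E pq => [x||]//=.
  by rewrite -EFinD => -[] <-; rewrite addrC addKr.
by apply: eq_bigr => i _; rewrite qE -!EFinM.
Qed.

Theorem theorem7 (R : realType) (n : nat) (p : R) (q : \bar R)
    (Z : set 'rV[R]_n) :
  1 <= p ->
  (p%:E^-1 + q^-1 = 1)%E ->
  asymmetric_L1_zonoid Z ->
  Z 0 ->
  (lebesgue_rV (Lp_sum p Z (-%R @` Z)) <=
     (kappa_s n q)%:E * lebesgue_rV Z)%E /\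
  (parallelotope Z -> vertex Z 0 ->
   (lebesgue_rV (Lp_sum p Z (-%R @` Z)) =
     (kappa_s n q)%:E * lebesgue_rV Z)%E).
Proof.
move=> p1 pq zZ Z0; have p0 : 0 < p by rewrite (lt_le_trans _ p1).
have cZ : compact Z by case: zZ.
have coZ := zonoid_convex zZ; have [w symZ] := zonoid_symmetric zZ.
rewrite (kappa_sE _ _ pq) ?gt_eqF// Lp_sumE//.
have [->|pn1] := eqVneq p 1.
  have -> : lp_body (1 - 1^-1) Z = diff_body 1 1 Z.
    rewrite invr1 subrr; apply/seteqP; split => z.
      by move=> [l _]; rewrite !powRr0.
    by move=> h; exists 0; rewrite ?lexx ?ler01// !powRr0.
  by rewrite invr1 subrr kappa0 (lebesgue_diff_body cZ coZ symZ).
have r0 : 0 < 1 - p^-1 by rewrite subr_gt0 invf_lt1// lt_neqAle eq_sym pn1.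
split; first exact: (lp_body_volume_upper cZ coZ Z0 symZ).
exact: (lp_body_volume_parallelotope cZ coZ Z0 symZ).
Qed.
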